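(* (1) Let $a>\frac14$ be such that the rotation number $\rho(a)$ of the elliptic transformation $z\mapsto-\frac{a}{z+1}$ is rational. Then there exists a sequence $(a_i)_{i\ge1}$ of positive real numbers with $a_i\to a$ such that the continued fraction $$\frac{-a_1}{1-\frac{a_2}{1-\frac{a_3}{1-\dots}}}$$ converges. (2) Moreover, let $\{T_s\}_{s\in\mathbb R}$ be any smooth family of elliptic Möbius transformations $T_s:H\to H$ with a smooth family of fixed points $c(s)\in \mathrm{Int}(H)$, $T_s(c(s))=c(s)$, and let $\rho(s)\in\mathbb R/\mathbb Z$ be the rotation number of $T_s$. Let $a\in\mathbb R$ be a parameter value such that $\rho(a)=\frac pq$ is rational ($p,q$ integers, $q\ge1$), $\rho(a)\ne 0,\frac12$ in $\mathbb R/\mathbb Z$, and $c'(a)\neq0$. Then there exists a real sequence $(a_i)_{i\ge1}$ with $a_i\to a$ such that the sequence $$\tau_n=T_{a_1}\circ\dots\circ T_{a_n}(0)$$ converges in $\partial H$. Furthermore, for any given sequence $(r_i)_{i\ge1}$ with $r_i>0$, $r_i\to0$ and $\sum_i r_i=\infty$, the sequence $(a_i)$ (with $\tau_n$ convergent) can be chosen so that $a_i\to a$, $a_i=a$ whenever $i\not\equiv1,2\pmod q$, and $a_{qi+1}-a=O(r_i)$, $a_{qi+2}-a=O(r_i)$ as $i\to\infty$.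
   Context: $H=\{\operatorname{Im} z\ge 0\}\cup\{\infty\}$ is the closed upper half-plane in the Riemann sphere, $\mathrm{Int}(H)=\{\operatorname{Im}z>0\}$, $\partial H=\mathbb R\cup\{\infty\}$ (a circle). A Möbius transformation $T:H\to H$ is called elliptic if it has a fixed point in $\mathrm{Int}(H)$; it is then Möbius conjugate to a rotation of the unit disc, and its rotation number is $(2\pi)^{-1}$ times the rotation angle, an element of $\mathbb R/\mathbb Z$. The orientation for measuring the angle is fixed so that for $a>\frac14$ the map $z\mapsto -\frac a{z+1}$ (which is elliptic) has rotation number $\rho(a)\in(0,\frac12)$; that is, an elliptic $T$ with fixed point $c\in\mathrm{Int}(H)$ has rotation number $\rho$ where $T'(c)=e^{-2\pi i\rho}$. Convergence of the continued fraction in (1) means: with $S_b(z)=-\frac b{z+1}$ for $b>0$, the sequence of approximants $S_{a_1}\circ\dots\circ S_{a_n}(0)\in\mathbb R\cup\{\infty\}$ converges in $\partial H=\mathbb R\cup\{\infty\}$ as $n\to\infty$. *)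

(* Defs.v *)
From HB Require Import structures.
From mathcomp Require Import all_boot all_order all_algebra complex.
From mathcomp Require Import all_classical all_reals all_analysis.
Import Order.TTheory GRing.Theory Num.Theory numFieldNormedType.Exports.

Set Implicit Arguments.
Unset Strict Implicit.
Unset Printing Implicit Defensive.

Local Open Scope classical_set_scope.
Local Open Scope ring_scope.
Local Open Scope complex_scope.

(* [R[i]] carries no topology by itself; the alias [R[i]^o] is the normed
   module of the numFieldType [R[i]] over itself. *)
Notation cplx R := ((R : realType)[i]^o).
Notation sphere R := (one_point_compactification (cplx R)).

Definition halfplane (R : realType) : set (sphere R) :=
  [set z | if z is Some w then 0 <= complex.Im w else True].
Definition int_halfplane (R : realType) : set (cplx R) :=
  [set w | 0 < complex.Im w].
Definition bd_halfplane (R : realType) : set (sphere R) :=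
  [set z | if z is Some w then complex.Im w = 0 else True].
Arguments halfplane : clear implicits.
Arguments int_halfplane : clear implicits.
Arguments bd_halfplane : clear implicits.

Definition moebius (R : realType) (al be ga de : cplx R) (z : sphere R) :
    sphere R :=
  match z with
  | Some w => if ga * w + de == 0 then None
              else Some ((al * w + be) / (ga * w + de))
  | None => if ga == 0 then None else Some (al / ga)
  end.

(* "T : H -> H" is read as T(H) = H. *)
Definition moebius_of_halfplane (R : realType) (T : sphere R -> sphere R) :=
  (exists al be ga de : cplx R,
     al * de - be * ga != 0 /\ T =1 moebius al be ga de) /\
  T @` halfplane R = halfplane R.

Definition elliptic (R : realType) (T : sphere R -> sphere R) :=
  moebius_of_halfplane T /\
  exists2 c : cplx R, int_halfplane R c & T (Some c) = Some c.

Definition expi (R : realType) (t : R) : cplx R := cos t +i* sin t.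

(* The class of [rho] modulo 1 is the rotation number of [T]. The map whose
   derivative is taken is the expression of [T] in the affine chart; it is
   finite near the fixed point [c], and [is_derive] over the scalar field
   [R[i]] is complex differentiation. *)
Definition has_rotation_number (R : realType) (T : sphere R -> sphere R)
    (rho : R) :=
  exists c : cplx R, [/\ int_halfplane R c, T (Some c) = Some c &
    is_derive c (1 : cplx R) ((fun z => odflt 0 (T (Some z))) : cplx R -> cplx R)
      (expi (- (2 * pi * rho)))].

(* Equality in R/Z of the classes of two real numbers. *)
Definition eq_mod1 (R : realType) (x y : R) := x - y \is a Num.int.

Definition smooth (R : realType) (f : R -> R) :=
  forall (n : nat) (x : R), derivable (derive1n n f) x 1.

Definition csmooth (R : realType) (f : R -> cplx R) :=
  smooth (fun s => complex.Re (f s)) /\ smooth (fun s => complex.Im (f s)).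

Definition cderive1 (R : realType) (f : R -> cplx R) (s : R) : cplx R :=
  derive1 (fun t => complex.Re (f t)) s +i* derive1 (fun t => complex.Im (f t)) s.

(* Every smooth map from the line to PGL_2(C) lifts to GL_2(C), so asking for
   globally defined smooth coefficients loses no generality. *)
Definition smooth_moebius_family (R : realType)
    (T : R -> sphere R -> sphere R) :=
  exists al be ga de : R -> cplx R,
    [/\ csmooth al, csmooth be, csmooth ga, csmooth de &
        forall s, al s * de s - be s * ga s != 0 /\
                  T s =1 moebius (al s) (be s) (ga s) (de s)].

(* z |-> - b / (z + 1) *)
Definition cf_map (R : realType) (b : R) : sphere R -> sphere R :=
  moebius 0 (- b%:C) 1 1.

(* T_(a 1) (T_(a 2) (... (T_(a n) 0))); [a 0] is not used. *)
Definition approximant (R : realType) (T : R -> sphere R -> sphere R)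
    (a : nat -> R) (n : nat) : sphere R :=
  foldr (fun i z => T (a i) z) (Some 0) (iota 1 n).

Definition converges_in_bd (R : realType) (u : nat -> sphere R) :=
  exists2 l : sphere R, bd_halfplane R l & u @ \oo --> l.

(* Main.v *)
(* Near the parameter [a], [T_s] acts on the extended real line by a real matrix
   [A(s) = ((p, -n), (1, d))] whose entries are differentiable at [a], and
   [A(a)^q] is scalar. A block of [q] maps with parameters [a + u e], [a + v e],
   [a], ..., [a] is therefore [exp(e Y + o(e))] with
   [Y = u X + v A X A^-1] and [X = A' A^-1]. As [A] is neither the identity nor
   an involution and the fixed point moves, the Wronskian of the vector fields
   [X] and [A X A^-1] is a nonzero quadratic polynomial; hence for all but
   finitely many real [t] one can choose [(u, v)] making [t] a repelling zero
   of [Y], and [t] may be taken off the finite orbit of [0] under [T_a].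
   In the coordinate [1 / (z - t)] all small blocks then map one fixed interval
   [[-M, M]] into itself with Lipschitz constant [1 - k e], and this interval
   contains the images of [0] under all initial pieces of a block. As the sum of
   the [e_i] diverges, the nested images shrink to a point, which is the limit. *)
Require Import Defs.
From HB Require Import structures.
From mathcomp Require Import all_boot all_order all_algebra complex.
From mathcomp Require Import all_classical all_reals all_analysis.
From mathcomp Require Import ring lra zify.
Import Order.TTheory GRing.Theory Num.Theory numFieldNormedType.Exports.

Local Open Scope classical_set_scope.
Local Open Scope ring_scope.
Local Open Scope complex_scope.

(** * Uniform contraction of Möbius maps near the identity *)

Lemma is_derive_expansion (R : realType) (f : R -> R) (x f1 : R) :
  is_derive x (1 : R) f f1 -> forall eta, 0 < eta ->
  \forall e \near (0 : R), `|f (x + e) - f x - f1 * e| <= eta * `|e|.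
Proof.
case=> df <- eta eta0.
have : h^-1 *: (f (h *: 1 + x) - f x) @[h --> 0^'] --> 'D_1 f x by exact: df.
move/cvgrPdist_le => /(_ eta eta0).
rewrite /dnbhs /within /= => H; near=> e.
have [->|e0] := eqVneq e 0; first by rewrite addr0 subrr mulr0 subrr normr0 mulr0.
have : e != 0 -> `|'D_1 f x - e^-1 *: (f (e *: 1 + x) - f x)| <= eta.
  by near: e; exact: H.
move=> /(_ e0).
have -> : f (x + e) - f x - 'D_1 f x * e =
   - (('D_1 f x - e^-1 *: (f (e *: 1 + x) - f x)) * e).
  rewrite /GRing.scale /= mulr1 [e + x]addrC; field.
  by [].
by rewrite normrN normrM => h; rewrite ler_wpM2r.
Unshelve. all: by end_near. Qed.

(** Here [p] stands for a small multiple of the step. The factor [x] gains [7 / 8 * p]; the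
    translation [y] and the pole term [z * w] give back only part of this gain. *)
Lemma disc_contraction (R : realFieldType) (x y z M p : R) :
  0 <= p <= 2^-1 -> 0 < M -> 0 <= x <= 1 - 7 / 8 * p -> `|y| <= p * M / 4 ->
  `|z| * M <= p / 16 ->
  [/\ forall w, `|w| <= M -> 0 < z * w + 1,
      forall w, `|w| <= M -> `|(x * w + y) / (z * w + 1)| <= M
    & forall w w', `|w| <= M -> `|w'| <= M ->
      `|(x * w + y) / (z * w + 1) - (x * w' + y) / (z * w' + 1)|
        <= (1 - p / 4) * `|w - w'|].
Proof.
move=> /andP[p0 p1] M0 /andP[x0 x1] yM zM.
have den w : `|w| <= M -> 1 - p / 16 <= z * w + 1.
  move=> wM; have : `|z * w| <= p / 16.
    by rewrite (le_trans _ zM) // normrM ler_wpM2l.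
  by rewrite ler_norml => /andP[h _]; lra.
have den0 w : `|w| <= M -> 0 < z * w + 1 by move=> /den h; lra.
split=> // [w wM | w w' wM w'M].
  have h := den w wM; have h0 := den0 w wM.
  rewrite normrM normfV (gtr0_norm h0) ler_pdivrMr //.
  apply: (@le_trans _ _ ((1 - p / 16) * M)); last first.
    by rewrite mulrC ler_wpM2l // ltW.
  rewrite (le_trans (ler_normD _ _)) // normrM (ger0_norm x0).
  have : x * `|w| <= (1 - 7 / 8 * p) * M by apply: ler_pM.
  have : 0 <= p * M by rewrite mulr_ge0 // ltW.
  clear -yM; lra.
have h := den w wM; have h' := den w' w'M.
have h0 := den0 w wM; have h0' := den0 w' w'M.
(* The difference of two values of a Möbius map is its determinant over the product of the
   denominators, times [w - w']. *)
have -> : (x * w + y) / (z * w + 1) - (x * w' + y) / (z * w' + 1) =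
   (x - y * z) / ((z * w + 1) * (z * w' + 1)) * (w - w').
  by field; rewrite !gt_eqF.
rewrite normrM ler_wpM2r // normrM normfV.
have d0 := mulr_gt0 h0 h0'.
rewrite (gtr0_norm d0) ler_pdivrMr //.
have p2 : 0 <= p * p by rewrite mulr_ge0.
have p21 : p * p <= 2^-1 * p by rewrite ler_wpM2r.
have p31 : p * (p * p) <= 2^-1 * (p * p) by rewrite ler_wpM2r.
have Hyz : `|y * z| <= p / 64.
  rewrite normrM; apply: (@le_trans _ _ (p * M / 4 * `|z|)).
    by rewrite ler_wpM2r.
  have : p * (`|z| * M) <= p * (p / 16) by rewrite ler_wpM2l.
  clear -p0 p21; lra.
apply: (@le_trans _ _ (1 - 7 / 8 * p + p / 64)).
  by rewrite (le_trans (ler_normB _ _)) // lerD // (ger0_norm x0).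
apply: (@le_trans _ _ ((1 - p / 4) * ((1 - p / 16) * (1 - p / 16)))).
  clear -p0 p2 p21 p31; lra.
have q0 : 0 <= 1 - p / 16 by clear -p1; lra.
by rewrite ler_wpM2l ?ler_pM //; clear -p1; lra.
Qed.

(** After division by [de], the map is [w |-> (1 - K e) w + (be1 / D) e] up to [o(e)], since [ga]
    has derivative [0]. Infinity is thus a repelling fixed point to first order, and large intervals
    [[-M, M]] are contracted. *)
Lemma moebius_contraction (R : realType) (al be ga de : R -> R)
    (D al1 be1 de1 : R) :
  is_derive (0 : R) (1 : R) al al1 -> is_derive (0 : R) (1 : R) be be1 ->
  is_derive (0 : R) (1 : R) ga 0 -> is_derive (0 : R) (1 : R) de de1 ->
  al 0 = D -> be 0 = 0 -> ga 0 = 0 -> de 0 = D -> 0 < D -> al1 < de1 ->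
  forall M0, exists2 M, M0 <= M & exists2 k, 0 < k &
    \forall e \near (0 : R), 0 <= e ->
    [/\ k * e <= 1,
      forall w, `|w| <= M -> ga e * w + de e != 0,
      forall w, `|w| <= M -> `|(al e * w + be e) / (ga e * w + de e)| <= M
    & forall w z, `|w| <= M -> `|z| <= M ->
      `|(al e * w + be e) / (ga e * w + de e) -
        (al e * z + be e) / (ga e * z + de e)| <= (1 - k * e) * `|w - z|].
Proof.
move=> dal dbe dga dde al0 be0 ga0 de0 D0 al1de1 M0.
have de00 : de 0 != 0 by rewrite de0 gt_eqF.
pose a e := al e / de e; pose b e := be e / de e; pose c e := ga e / de e.
have dV : is_derive (0 : R) (1 : R) (fun e => (de e)^-1) (- D^-2 * de1).
  by rewrite -de0; apply: is_deriveV.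
pose K := (de1 - al1) / D.
have K0 : 0 < K by rewrite divr_gt0 // subr_gt0.
have da : is_derive (0 : R) (1 : R) a (- K).
  have := is_deriveM dal dV; rewrite /GRing.scale /= al0 de0 => h.
  apply: is_derive_eq; rewrite /K; field; exact: lt0r_neq0.
have db : is_derive (0 : R) (1 : R) b (be1 / D).
  have := is_deriveM dbe dV; rewrite /GRing.scale /= be0 de0 => h.
  apply: is_derive_eq; field; exact: lt0r_neq0.
have dc : is_derive (0 : R) (1 : R) c 0.
  have := is_deriveM dga dV; rewrite /GRing.scale /= ga0 de0 => h.
  apply: is_derive_eq; field; exact: lt0r_neq0.
have a0 : a 0 = 1 by rewrite /a al0 de0 divff // lt0r_neq0.
have b0 : b 0 = 0 by rewrite /b be0 mul0r.
have c0 : c 0 = 0 by rewrite /c ga0 mul0r.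
pose B := `|be1 / D| + 1.
have B0 : 0 < B by rewrite /B; have := normr_ge0 (be1 / D); lra.
(* [M] is so large that a translation of size [B * e] is at most [K * e * M / 4]. *)
pose M := Num.max (Num.max M0 1) (4 * B / K).
have M1 : 1 <= M by rewrite /M !le_max lexx orbT.
have MM0 : M0 <= M by rewrite /M !le_max lexx.
have MB : 4 * B <= K * M.
  have : 4 * B / K <= M by rewrite /M le_max lexx orbT.
  by rewrite ler_pdivrMr // mulrC [M * K]mulrC [B * 4]mulrC.
exists M => //; exists (K / 4); first by lra.
(* This precision keeps [|c e| * M] at most [K * e / 16]. *)
pose eta := K / (16 * M).
have eta0 : 0 < eta by apply: divr_gt0 => //; lra.
have etaM : 16 * (eta * M) = K by rewrite /eta; field; lra.
have etaK : eta <= K / 16 by have : eta * 1 <= eta * M; [rewrite ler_wpM2l // ltW | lra].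
have K80 : 0 < K / 8 by lra.
have Ea := is_derive_expansion _ _ _ _ da (K / 8) K80.
have Eb := is_derive_expansion _ _ _ _ db 1 ltr01.
have Ec := is_derive_expansion _ _ _ _ dc eta eta0.
have dene : \forall e \near (0 : R), de e != 0.
  have dec : {for 0, continuous de} by apply/differentiable_continuous/derivable1_diffP; case: dde.
  by have := dec; move/cvgr_neq0; apply.
near=> e => e0.
have eK : K * e <= 2^-1.
  have : e <= K^-1 / 2 by near: e; apply: nbhs0_ltW; rewrite divr_gt0 ?invr_gt0.
  by rewrite -ler_pdivlMl.
have de0' : de e != 0 by near: e; exact: dene.
set x := a e; set y := b e; set z := c e.
have Hx : `|x - 1 + K * e| <= K / 8 * e.
  have : `|a (0 + e) - a 0 - - K * e| <= K / 8 * `|e| by near: e; exact: Ea.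
  by rewrite add0r a0 mulNr opprK (ger0_norm e0).
have Hy : `|y| <= K * e * M / 4.
  have : `|b (0 + e) - b 0 - be1 / D * e| <= 1 * `|e| by near: e; exact: Eb.
  rewrite add0r b0 subr0 mul1r (ger0_norm e0) => H.
  apply: (@le_trans _ _ (B * e)).
    have -> : y = (y - be1 / D * e) + be1 / D * e by ring.
    rewrite (le_trans (ler_normD _ _)) // normrM (ger0_norm e0) /B mulrDl mul1r.
    by rewrite addrC lerD2l.
  have : 4 * B * e <= K * M * e by rewrite ler_wpM2r.
  clear; lra.
have Hz : `|z| * M <= K * e / 16.
  have : `|c (0 + e) - c 0 - 0 * e| <= eta * `|e| by near: e; exact: Ec.
  rewrite add0r c0 mul0r !subr0 (ger0_norm e0) => H.
  have -> : K * e / 16 = eta * e * M by rewrite -etaM; field.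
  by rewrite ler_wpM2r // (le_trans ler01).
have Ke0 : 0 <= K * e by rewrite mulr_ge0 // ltW.
have Hp : 0 <= K * e <= 2^-1 by rewrite Ke0.
have Hx1 : 0 <= x <= 1 - 7 / 8 * (K * e).
  move: Hx; rewrite ler_norml => /andP[h1 h2].
  by clear -h1 h2 eK; apply/andP; split; lra.
have [den ball lip] := disc_contraction _ _ _ _ _ _ Hp (lt_le_trans ltr01 M1) Hx1 Hy Hz.
have dn w : ga e * w + de e = de e * (z * w + 1) by rewrite /z /c; field.
have red w : (al e * w + be e) / (ga e * w + de e) = (x * w + y) / (z * w + 1).
  have -> : al e * w + be e = de e * (x * w + y) by rewrite /x /y /a /b; field.
  by rewrite dn -mulf_div divff // mul1r.
split=> [|w wM|w wM|w w' wM w'M].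
- by clear -eK; lra.
- by rewrite dn mulf_neq0 // gt_eqF // den.
- by rewrite red; exact: ball.
- have -> : K / 4 * e = K * e / 4 by field.
  rewrite !red; exact: (lip w w').
Unshelve. all: by end_near. Qed.

(** * Limits of infinite compositions of contractions *)

(** Lipschitz constants multiply, and [1 - e i <= expR (- e i)] turns their product into the
    exponential of a sum. *)
Lemma foldr_contraction (R : realType) (f : nat -> R -> R) (e : nat -> R)
    (M : R) :
  (forall i, 0 <= e i <= 1) ->
  (forall i x, `|x| <= M -> `|f i x| <= M) ->
  (forall i x y, `|x| <= M -> `|y| <= M ->
     `|f i x - f i y| <= (1 - e i) * `|x - y|) ->
  forall m n x y, `|x| <= M -> `|y| <= M ->
  `|foldr f x (iota m n)| <= M /\
  `|foldr f x (iota m n) - foldr f y (iota m n)| <=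
    expR (- \sum_(m <= i < m + n) e i) * `|x - y|.
Proof.
move=> e01 fM fL m n x y xM yM; elim: n m => [|n IH] m /=.
  by rewrite addn0 big_geq // oppr0 expR0 mul1r.
have [IH1 IH2] := IH m.+1; split; first exact: fM.
have yM' : `|foldr f y (iota m.+1 n)| <= M.
  by elim: n {IH IH1 IH2} (m.+1) => //= n IHn j; apply: fM.
rewrite (le_trans (fL _ _ _ IH1 yM')) //.
have [e0 e1] := andP (e01 m).
rewrite big_ltn ?addnS ?ltnS ?leq_addr // opprD expRD -mulrA.
apply: ler_pM => //; first by rewrite subr_ge0.
exact: expR_ge1Dx.
Qed.

(** For large [N], [w N] lies in the image of [[-M, M]] under the first [n] maps. The diameters of
    these nested images tend to [0], so [w] is Cauchy. The starting point [x] may vary with [N],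
    which accommodates incomplete blocks. *)
Lemma nested_contraction_cvg (R : realType) (f : nat -> R -> R) (e : nat -> R)
    (M : R) (q : nat) (w : nat -> R) :
  (forall i, 0 <= e i <= 1) -> (0 < q)%N ->
  (\sum_(0 <= i < n) e i) @[n --> \oo] --> +oo ->
  (forall i x, `|x| <= M -> `|f i x| <= M) ->
  (forall i x y, `|x| <= M -> `|y| <= M ->
     `|f i x - f i y| <= (1 - e i) * `|x - y|) ->
  (\forall N \near \oo, exists2 x, `|x| <= M &
     w N = foldr f x (iota 0 (N %/ q))) ->
  cvgn w.
Proof.
move=> e01 q0 eoo fM fL [N0 _ wE]; apply: cauchy_cvg; apply: cauchy_exP => eps eps0.
have E := foldr_contraction _ _ _ _ e01 fM fL.
have M1 : 0 < 2 * `|M| + 1 by rewrite ltr_wpDl // mulr_ge0.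
have : expR (- \sum_(0 <= i < n) e i) @[n --> \oo] --> (0 : R).
  exact: (cvg_comp _ _ eoo (@cvgr_expR R)).
move=> /cvgrPdist_lt /(_ (eps / (2 * `|M| + 1))) /(_ (divr_gt0 eps0 M1)).
case=> n _ /(_ n (leqnn n)).
rewrite sub0r normrN ger0_norm ?expR_ge0 // => Hn.
(* The [n] outer maps are split off; the remaining [N %/ q - n] inner maps keep the point in the
   interval. *)
have tail N : (N0 <= N)%N -> (q * n <= N)%N -> exists2 x, `|x| <= M &
    w N = foldr f x (iota 0 n).
  move=> /wE [x xM ->] qn.
  have nN : (n <= N %/ q)%N by rewrite leq_divRL // mulnC.
  exists (foldr f x (iota n (N %/ q - n))).
    exact: (E _ _ x x xM xM).1.
  by rewrite -[X in iota 0 X](subnKC nN) iotaD foldr_cat.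
pose Nb := (N0 + q * n)%N.
have [x xM wx] := tail Nb (leq_addr _ _) (leq_addl _ _).
exists (w Nb); exists Nb => // N /= NN.
have [|y yM wy] := tail N _ (leq_trans (leq_addl _ _) NN).
  exact: leq_trans (leq_addr _ _) NN.
rewrite /ball /= wx wy (le_lt_trans (E 0%N n x y xM yM).2) // add0n.
apply: (@le_lt_trans _ _ (expR (- \sum_(0 <= i < n) e i) * (2 * `|M| + 1))).
  rewrite ler_wpM2l ?expR_ge0 // (le_trans (ler_normB _ _)) //.
  by have := ler_norm M; lra.
by rewrite -ltr_pdivlMr.
Qed.

(** * The extended real line in the Riemann sphere *)

Lemma continuous_Re (R : realType) : continuous (@complex.Re R : cplx R -> R).
Proof.
move=> z; have FF : Filter (nbhs (z : cplx R)) by typeclasses eauto.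
apply/(@cvgrPdist_lt R R _ _ FF) => e e0.
have e0' : 0 < e%:C :> R[i] by rewrite ltcR.
near=> w; rewrite -ltcR; apply: (@le_lt_trans _ _ `|z - w|).
  by have := normc_ge_Re (z - w); case: (z) => ? ?; case: (w) => ? ?.
near: w; exact: (@cvgr_dist_lt _ _ _ (nbhs z) _ id z cvg_id).
Unshelve. all: by end_near. Qed.

Lemma continuous_real_complex (R : realType) :
  continuous (fun x : R => x%:C : cplx R).
Proof.
move=> x; apply/cvgrPdist_lt => -[e im]; rewrite ltcE /= => /andP[/eqP -> e0].
have : \forall y \near x, `|x - y| < e.
  exact: (@cvgr_dist_lt _ _ _ (nbhs x) _ id x cvg_id).
apply: filterS => y xy.
by rewrite -rmorphB /= normc_def /= expr0n /= addr0 sqrtr_sqr ltcR.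
Qed.

(* [real_pt t w] is the point [z] of the extended real line such that
   [w = 1 / (z - t)]. *)
Definition real_pt (R : realType) (t w : R) : sphere R :=
  if w == 0 then None else Some ((t + w^-1)%:C : cplx R).

(** At [w = 0] the value is infinity. A neighbourhood of infinity omits only a compact set, whose
    real parts are bounded, whereas [t + w^-1] is unbounded as [w] tends to [0]. *)
Lemma continuous_real_pt (R : realType) (t : R) : continuous (real_pt R t).
Proof.
move=> l; have [->|l0] := eqVneq l 0; last first.
  have : Some ((t + w^-1)%:C : cplx R) @[w --> l] --> real_pt R t l.
    rewrite /real_pt (negbTE l0).
    apply: (@cvg_comp _ _ _ (fun w : R => (t + w^-1)%:C : cplx R)
      (Some : cplx R -> sphere R) (nbhs l) (nbhs ((t + l^-1)%:C : cplx R))); last first.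
      exact: one_point_compactification_some_continuous.
    apply: (@cvg_comp _ _ _ (fun w : R => t + w^-1)
      (fun x : R => x%:C : cplx R) (nbhs l) (nbhs (t + l^-1))); last first.
      exact: continuous_real_complex.
    by apply: cvgD; [exact: cvg_cst | apply: cvgV => //; exact: cvg_id].
  apply: cvg_trans; apply: near_eq_cvg; near=> w.
  rewrite /real_pt ifN //; near: w.
  exact: (@cvgr_neq0 _ _ _ _ _ _ l cvg_id l0).
have E : real_pt R t 0 = None by rewrite /real_pt eqxx.
rewrite /continuous_at E => U [K [cK _] KU].
have cRe : compact (@complex.Re R @` (K : set (cplx R))).
  apply: continuous_compact => //; apply: continuous_subspaceT => z.
  exact: continuous_Re.
have [N [_ /(_ (`|N| + 1))]] := compact_bounded cRe.
rewrite (le_lt_trans (ler_norm _)) ?ltrDl // => /(_ isT) NK.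
change (\forall w \near (0 : R), U (real_pt R t w)).
near=> w; apply: KU; rewrite /real_pt.
case: ifPn => [_|w0]; [by right | left].
exists ((t + w^-1)%:C : cplx R) => // Kw.
have /NK : (@complex.Re R @` (K : set (cplx R))) (t + w^-1).
  by exists (t + w^-1)%:C.
apply/negP; rewrite -ltNge.
(* After subtraction of [|t|] this constant still exceeds [|N| + 1], the bound on the real parts. *)
have C0 : 0 < `|N| + `|t| + 2 by have := normr_ge0 N; have := normr_ge0 t; lra.
have wC : `|w| < (`|N| + `|t| + 2)^-1.
  near: w; apply: cvgr0_norm_lt; first exact: cvg_id.
  by rewrite invr_gt0.
have iw : `|N| + `|t| + 2 < `|w^-1|.
  by rewrite normfV -[X in X < _]invrK ltf_pV2 // posrE ?invr_gt0 // normr_gt0.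
have := ler_normB (t + w^-1) t; rewrite addrC addKr.
by move=> h; lra.
Unshelve. all: by end_near. Qed.

(** * First variation of a block and the choice of the direction [(u, v)] *)

(* Derivatives at [e = 0] of the two coordinates of
   [A(a + u e) A(a + v e) (x, y)], where [A = ((p, -n), (1, d))] has derivative
   [((p1, -n1), (0, d1))] at [a]. *)
Definition dblock1 (R : pzRingType) (p n d p1 n1 d1 u v x y : R) : R :=
  u * (p1 * (p * x - n * y) - n1 * (x + d * y)) +
  v * (p * (p1 * x - n1 * y) - n * (d1 * y)).
Definition dblock2 (R : pzRingType) (d p1 n1 d1 u v x y : R) : R :=
  u * (d1 * (x + d * y)) + v * (p1 * x - n1 * y + d * (d1 * y)).

(* The two coordinates of the square of the adjugate of [((p, -n), (1, d))],
   applied to [(x, y)]. *)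
Definition adj2_1 (R : pzRingType) (p n d x y : R) : R :=
  (d * d - n) * x + n * (p + d) * y.
Definition adj2_2 (R : pzRingType) (p n d x y : R) : R :=
  - (p + d) * x + (p * p - n) * y.

(** The product with all ['X - x%:P] turns avoidance of [F] into avoidance of the roots of one
    nonzero polynomial [P]; among [size P] distinct integers one is not a root. *)
Lemma quadratic_nonroot (R : realFieldType) (w0 w1 w2 : R) (F : seq R) :
  ~ [/\ w0 = 0, w1 = 0 & w2 = 0] ->
  exists2 t, t \notin F & w0 + w1 * t + w2 * t ^+ 2 != 0.
Proof.
move=> w; pose P := (Poly [:: w0; w1; w2]) * \prod_(x <- F) ('X - x%:P).
have P0 : P != 0.
  rewrite mulf_neq0 ?(monic_neq0 (monic_prod_XsubC _ _ _)) //.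
  apply/eqP => h; apply: w.
  have c i : [:: w0; w1; w2]`_i = 0 by rewrite -coef_Poly h coef0.
  by split; [exact: (c 0%N) | exact: (c 1%N) | exact: (c 2%N)].
pose s := [seq (i%:R : R) | i <- iota 0 (size P)].
have us : uniq s by rewrite map_inj_uniq ?iota_uniq // => i j /eqP; rewrite eqr_nat => /eqP.
have : ~~ all (root P) s.
  by apply/negP => /(max_poly_roots P0) /(_ us); rewrite size_map size_iota ltnn.
move=> /allPn[t _ tP]; exists t; move: tP; rewrite rootM negb_or root_prod_XsubC => /andP[] //.
by rewrite /root horner_Poly /= => h _; apply: contra h => /eqP e; apply/eqP; rewrite -[RHS]e; ring.
Qed.

(** The equation makes [t] a zero of the vector field of the block, the inequality makes it
    repelling. Both expressions are linear in [(u, v)], so a solution exists wherever the Wronskian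
    of the two basic fields is nonzero. *)
Lemma hyperbolic_direction (R : realFieldType) (p n d p1 n1 d1 : R) (F : seq R) :
  p + d != 0 -> (p - d) ^+ 2 < 4 * n -> (p1 != d1) || (n1 != 0) ->
  exists t u v, let b1 := dblock1 _ p n d p1 n1 d1 u v in
    let b2 := dblock2 _ d p1 n1 d1 u v in
    let xt := adj2_1 _ p n d t 1 in let yt := adj2_2 _ p n d t 1 in
    let x0 := adj2_1 _ p n d 1 0 in let y0 := adj2_2 _ p n d 1 0 in
    [/\ t \notin F, b1 xt yt - t * b2 xt yt = 0 &
      b2 xt yt < b1 x0 y0 - t * b2 x0 y0].
Proof.
move=> tr0 ell der.
pose xt t := adj2_1 _ p n d t 1; pose yt t := adj2_2 _ p n d t 1.
pose x0 := adj2_1 _ p n d 1 0; pose y0 := adj2_2 _ p n d 1 0.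
pose b1 u v := dblock1 _ p n d p1 n1 d1 u v.
pose b2 u v := dblock2 _ d p1 n1 d1 u v.
pose Q u v t := b1 u v (xt t) (yt t) - t * b2 u v (xt t) (yt t).
(* [E u v t] is minus the derivative of [Q u v t] in [t], so [W] is the Wronskian of [Q 1 0] and
   [Q 0 1]. *)
pose E u v t := b2 u v (xt t) (yt t) - (b1 u v x0 y0 - t * b2 u v x0 y0).
pose W t := Q 0 1 t * E 1 0 t - Q 1 0 t * E 0 1 t.
pose w0 := W 0; pose w1 := (W 1 - W (-1)) / 2; pose w2 := (W 1 + W (-1)) / 2 - W 0.
have WE t : W t = w0 + w1 * t + w2 * t ^+ 2.
  rewrite /w0 /w1 /w2 /W /Q /E /b1 /b2 /xt /yt /x0 /y0 /adj2_1 /adj2_2 /dblock1 /dblock2.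
  by field.
(* The left side is the invariant pairing of [W] with the fixed-point polynomial
   [t^2 - (p - d) t + n]. The right side is a nonzero multiple of a quadratic form in
   [(p1 - d1, n1)], which is definite by ellipticity. *)
have pairing : 2 * w2 * n + 2 * w0 + (p - d) * w1 =
    - 2 * (p * d + n) ^+ 2 * (p + d) *
    (n * (p1 - d1) ^+ 2 + n1 ^+ 2 - (p - d) * (p1 - d1) * n1).
  rewrite /w0 /w1 /w2 /W /Q /E /b1 /b2 /xt /yt /x0 /y0 /adj2_1 /adj2_2 /dblock1 /dblock2.
  by field.
have [|t tF tW] := quadratic_nonroot _ w0 w1 w2 F.
  move=> [w00 w10 w20]; move: pairing; rewrite w00 w10 w20 !(mulr0, mul0r, addr0).
  apply/eqP; rewrite eq_sym.
  have D0 : p * d + n != 0 by rewrite gt_eqF //; have := sqr_ge0 (p + d); nra.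
  rewrite !mulf_neq0 ?expf_neq0 ?oppr_eq0 ?pnatr_eq0 // gt_eqF //.
  have -> : n * (p1 - d1) ^+ 2 + n1 ^+ 2 - (p - d) * (p1 - d1) * n1 =
     (n1 - (p - d) * (p1 - d1) / 2) ^+ 2 + (n - (p - d) ^+ 2 / 4) * (p1 - d1) ^+ 2
     by field.
  have n0 : 0 < n - (p - d) ^+ 2 / 4 by lra.
  have [e1|e1] := eqVneq p1 d1.
    move: der; rewrite e1 eqxx /= => n10.
    rewrite subrr !(mulr0, mul0r, expr0n) /= ?mulr0 subr0 addr0.
    by rewrite lt_neqAle sqr_ge0 eq_sym expf_neq0.
  rewrite ltr_wpDl ?sqr_ge0 // mulr_gt0 // lt_neqAle sqr_ge0 eq_sym expf_neq0 //.
  by rewrite subr_eq0.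
rewrite -WE in tW.
have lin u v : Q u v t = u * Q 1 0 t + v * Q 0 1 t.
  by rewrite /Q /b1 /b2 /dblock1 /dblock2; ring.
have linE u v : E u v t = u * E 1 0 t + v * E 0 1 t.
  by rewrite /E /b1 /b2 /dblock1 /dblock2; ring.
(* A pair [(u, v)] equal to [(Q 0 1 t, - Q 1 0 t)] up to sign makes [Q] vanish and [E] equal to
   [W t] up to the same sign, which is chosen so that [E] is negative. *)
have [W0|W0] := ltP (W t) 0.
  exists t, (Q 0 1 t), (- Q 1 0 t); split => //.
    by rewrite -[LHS]/(Q _ _ t) lin; ring.
  by rewrite -subr_lt0 -[X in X < 0]/(E _ _ t) linE mulNr.
exists t, (- Q 0 1 t), (Q 1 0 t); split => //.
  by rewrite -[LHS]/(Q _ _ t) lin; ring.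
rewrite -subr_lt0 -[X in X < 0]/(E _ _ t) linE mulNr addrC -oppr_gt0 opprB.
by rewrite lt_neqAle W0 eq_sym tW.
Qed.

(** * Blocks of [q] maps in homogeneous coordinates *)

(** This is the matrix [((p, -n), (1, d))] acting on vectors, so that no pole has to be treated
    until a chart is applied. *)
Definition lin (R : pzRingType) (p n d : R) (v : R * R) : R * R :=
  (p * v.1 - n * v.2, v.1 + d * v.2).

Definition proj (R : realType) (v : R * R) : sphere R :=
  if v.2 == 0 then None else Some ((v.1 / v.2)%:C : cplx R).

(* The coordinate [1 / (z - t)] of the point [z = v.1 / v.2]. *)
Definition chart (R : realFieldType) (t : R) (v : R * R) : R :=
  v.2 / (v.1 - t * v.2).

Lemma proj_chart (R : realType) (t : R) (v : R * R) :
  v.1 - t * v.2 != 0 -> proj R v = real_pt R t (chart R t v).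
Proof.
case: v => x y; rewrite /proj /real_pt /chart /= => h.
rewrite mulf_eq0 invr_eq0 (negbTE h) orbF.
have [//|y0] := eqVneq y 0; congr (Some (_)%:C); field.
by rewrite h.
Qed.

Lemma lin_neq0 (R : realFieldType) (p n d : R) (v : R * R) :
  p * d + n != 0 -> v != 0 -> lin R p n d v != 0.
Proof.
case: v => x y D0; apply: contra => /eqP [h1 h2]; apply/eqP.
have y0 : (p * d + n) * y = 0 by rewrite -[RHS](mulr0 p) -h2 -[LHS]addr0 -h1; ring.
have {}y0 : y = 0 by move/eqP: y0; rewrite mulf_eq0 (negbTE D0) => /eqP.
by move: h2; rewrite y0 mulr0 addr0 => ->.
Qed.

(** Only the first [j] maps of a block are composed, which describes approximants that stop inside a
    block. *)
Definition partial_block (R : pzRingType) (A : R -> R * R -> R * R) (a u v : R)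
    (j : nat) (e : R) (z : R * R) : R * R :=
  match j with
  | 0%N => z
  | 1%N => A (a + u * e) z
  | j.+2 => A (a + u * e) (A (a + v * e) (iter j (A a) z))
  end.

(** Indices start at [1]: block [i] runs from [q * i + 1] to [q * i + q]. The last index has
    quotient [i.+1], but its residue [0] multiplies the step by [0]. *)
Definition perturbation (R : pzRingType) (a u v : R) (q : nat) (e : nat -> R)
    (N : nat) : R :=
  a + (if (N %% q)%N == 1%N then u else if (N %% q)%N == 2%N then v else 0) * e (N %/ q)%N.

Lemma foldr_iotaD (T : Type) (f : nat -> T -> T) (z : T) (m k l : nat) :
  foldr f z (iota m (k + l)) = foldr f (foldr f z (iota (m + k) l)) (iota m k).
Proof. by rewrite iotaD foldr_cat. Qed.

Lemma foldr_block (R : pzRingType) (A : R -> R * R -> R * R) (a u v : R)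
    (q : nat) (e : nat -> R) (i j : nat) (z : R * R) : (2 < q)%N -> (j <= q)%N ->
  foldr (fun N => A (perturbation R a u v q e N)) z (iota (1 + q * i) j) =
  partial_block R A a u v j (e i) z.
Proof.
move=> q2 jq.
have pert k : (k < q)%N -> perturbation R a u v q e (q * i + k) =
    a + (if k == 1%N then u else if k == 2%N then v else 0) * e i.
  move=> kq; rewrite /perturbation mulnC modnMDl modn_small // divnMDl; last by lia.
  by rewrite divn_small // addn0.
have pertq : perturbation R a u v q e (q * i + q) = a.
  have -> : (q * i + q = q * i.+1)%N by lia.
  by rewrite /perturbation modnMr /= mul0r addr0.
have tail k : (k.+2 <= q)%N ->
  foldr (fun N => A (perturbation R a u v q e N)) z (iota (q * i + 3) k) =
    iter k (A a) z.
  move=> kq.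
  suff : forall m l, (3 <= m)%N -> (m + l <= q.+1)%N ->
    foldr (fun N => A (perturbation R a u v q e N)) z (iota (q * i + m) l) =
    iter l (A a) z by apply; lia.
  move=> m l; elim: l m => //= l IH m m3 ml.
  rewrite -addnS IH; [|lia..]; congr (A _ _).
  have [mq|mq] := ltnP m q; last by have -> : m = q by lia.
  by rewrite pert // ifN ?ifN ?mul0r ?addr0 //; lia.
rewrite addnC; case: j jq => [|[|j]] jq //=; first by rewrite pert //; lia.
have -> : ((q * i + 1).+1 = q * i + 2)%N by lia.
have -> : ((q * i + 2).+1 = q * i + 3)%N by lia.
by rewrite !pert ?tail //; lia.
Qed.

Lemma foldr_blocks (R : pzRingType) (A : R -> R * R -> R * R) (a u v : R)
    (q : nat) (e : nat -> R) (m j : nat) (z : R * R) : (2 < q)%N -> (j <= q)%N ->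
  foldr (fun N => A (perturbation R a u v q e N)) z (iota 1 (q * m + j)) =
  foldr (fun i => partial_block R A a u v q (e i))
    (partial_block R A a u v j (e m) z) (iota 0 m).
Proof.
move=> q2 jq; rewrite foldr_iotaD foldr_block //.
move: (partial_block _ _ _ _ _ j _ _) => {jq}z'.
elim: m z' => [|m IH] z'; first by rewrite muln0.
rewrite mulnS addnC foldr_iotaD foldr_block // IH.
by rewrite -[m.+1]addn1 foldr_iotaD.
Qed.

Lemma is_derive_affine (R : realType) (f : R -> R) (a f1 u : R) :
  is_derive a (1 : R) f f1 ->
  is_derive (0 : R) (1 : R) (fun e => f (a + u * e)) (u * f1).
Proof.
move=> df; rewrite mulrC.
apply: (@is_derive1_comp _ f (fun e => a + u * e)); first by rewrite mulr0 addr0.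
apply: is_derive_eq; rewrite /GRing.scale /=; ring.
Qed.

Lemma is_derive_block (R : realType) (p n d : R -> R) (a p1 n1 d1 u v x y : R) :
  is_derive a (1 : R) p p1 -> is_derive a (1 : R) n n1 ->
  is_derive a (1 : R) d d1 ->
  let A s := lin R (p s) (n s) (d s) in
  is_derive (0 : R) (1 : R) (fun e => (A (a + u * e) (A (a + v * e) (x, y))).1)
    (dblock1 R (p a) (n a) (d a) p1 n1 d1 u v x y) /\
  is_derive (0 : R) (1 : R) (fun e => (A (a + u * e) (A (a + v * e) (x, y))).2)
    (dblock2 R (d a) p1 n1 d1 u v x y).
Proof.
move=> dp dn dd A; rewrite /A /lin /=.
have dpu := is_derive_affine _ _ _ _ u dp; have dpv := is_derive_affine _ _ _ _ v dp.
have dnu := is_derive_affine _ _ _ _ u dn; have dnv := is_derive_affine _ _ _ _ v dn.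
have ddu := is_derive_affine _ _ _ _ u dd; have ddv := is_derive_affine _ _ _ _ v dd.
have c z : is_derive (0 : R) (1 : R) (fun=> z) (0 : R) by exact: is_derive_cst.
split.
  have h := is_deriveB (is_deriveM dpu (is_deriveB (is_deriveM dpv (c x)) (is_deriveM dnv (c y))))
    (is_deriveM dnu (is_deriveD (c x) (is_deriveM ddv (c y)))).
  apply: (is_derive_eq h); rewrite !fctE /GRing.scale /= !mulr0 !addr0 /dblock1; ring.
have h := is_deriveD (is_deriveB (is_deriveM dpv (c x)) (is_deriveM dnv (c y)))
    (is_deriveM ddu (is_deriveD (c x) (is_deriveM ddv (c y)))).
apply: (is_derive_eq h); rewrite !fctE /GRing.scale /= !mulr0 !addr0 /dblock2; ring.
Qed.

(* Multiplying [A^q = g] by the square of the adjugate of [A] expresses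
   [A^(q-2)] through that square. *)
Lemma iter_lin_adj2 (R : realFieldType) (p n d g : R) (q : nat) (z : R * R) :
  (2 <= q)%N -> p * d + n != 0 ->
  (forall z, iter q (lin R p n d) z = (g * z.1, g * z.2)) ->
  iter (q - 2) (lin R p n d) z =
    (g / (p * d + n) ^+ 2 * adj2_1 R p n d z.1 z.2,
     g / (p * d + n) ^+ 2 * adj2_2 R p n d z.1 z.2).
Proof.
move=> q2 D0 Aq; have := Aq z; rewrite -[in X in iter X](subnKC q2) iterD /=.
case: (iter _ _ _) => x y; rewrite /lin /= => -[h1 h2].
have e1 : g * adj2_1 R p n d z.1 z.2 = (p * d + n) ^+ 2 * x.
  transitivity (adj2_1 R p n d (g * z.1) (g * z.2)); first by rewrite /adj2_1; ring.
  by rewrite -h1 -h2 /adj2_1; ring.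
have e2 : g * adj2_2 R p n d z.1 z.2 = (p * d + n) ^+ 2 * y.
  transitivity (adj2_2 R p n d (g * z.1) (g * z.2)); first by rewrite /adj2_2; ring.
  by rewrite -h1 -h2 /adj2_2; ring.
by rewrite ![g / _ * _]mulrAC e1 e2 ![_ ^+ 2 * _]mulrC !mulfK ?expf_neq0.
Qed.

(** A vector with chart coordinate [w] is a multiple of [w (t, 1) + (1, 0)]. The chart therefore
    turns the block into a Möbius map whose coefficients come from the images of [(t, 1)] and
    [(1, 0)]; at [e = 0] they form a scalar matrix. The two conditions on [b1] and [b2] are those of
    [moebius_contraction] on the derivatives. *)
Lemma block_contraction (R : realType) (p n d : R -> R) (a p1 n1 d1 g t u v : R)
    (q : nat) :
  is_derive a (1 : R) p p1 -> is_derive a (1 : R) n n1 ->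
  is_derive a (1 : R) d d1 ->
  let A s := lin R (p s) (n s) (d s) in
  let b1 := dblock1 R (p a) (n a) (d a) p1 n1 d1 u v in
  let b2 := dblock2 R (d a) p1 n1 d1 u v in
  let xt := adj2_1 R (p a) (n a) (d a) t 1 in
  let yt := adj2_2 R (p a) (n a) (d a) t 1 in
  let x0 := adj2_1 R (p a) (n a) (d a) 1 0 in
  let y0 := adj2_2 R (p a) (n a) (d a) 1 0 in
  b1 xt yt - t * b2 xt yt = 0 -> b2 xt yt < b1 x0 y0 - t * b2 x0 y0 ->
  p a * d a + n a != 0 -> g != 0 -> (2 < q)%N ->
  (forall z, iter q (A a) z = (g * z.1, g * z.2)) ->
  exists f : R -> R -> R, forall M0, exists2 M, M0 <= M & exists2 k, 0 < k &
    \forall e \near (0 : R), 0 <= e ->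
    [/\ k * e <= 1,
      forall w, `|w| <= M -> `|f e w| <= M,
      forall w z, `|w| <= M -> `|z| <= M ->
        `|f e w - f e z| <= (1 - k * e) * `|w - z|
    & forall z, z.1 - t * z.2 != 0 -> `|chart R t z| <= M ->
      (partial_block R A a u v q e z).1 - t * (partial_block R A a u v q e z).2 != 0 /\
      chart R t (partial_block R A a u v q e z) = f e (chart R t z)].
Proof.
move=> dp dn dd A b1 b2 xt yt x0 y0 ga1 hyp D0 g0 q2 Aq.
have [dt1 dt2] := is_derive_block _ _ _ _ _ _ _ _ u v xt yt dp dn dd.
have [d01 d02] := is_derive_block _ _ _ _ _ _ _ _ u v x0 y0 dp dn dd.
rewrite -/A -/b1 -/b2 in dt1 dt2 d01 d02.
pose B x y e := A (a + u * e) (A (a + v * e) (x, y)).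
pose al e := (B xt yt e).2; pose be e := (B x0 y0 e).2.
pose ga e := (B xt yt e).1 - t * (B xt yt e).2.
pose de e := (B x0 y0 e).1 - t * (B x0 y0 e).2.
have D20 : 0 < (p a * d a + n a) ^+ 2 by rewrite lt_neqAle sqr_ge0 eq_sym expf_neq0.
have dga : is_derive (0 : R) (1 : R) ga 0.
  exact: (is_derive_eq (is_deriveB dt1 (is_deriveZ t dt2)) ga1).
have dde : is_derive (0 : R) (1 : R) de (b1 x0 y0 - t * b2 x0 y0).
  exact: (is_deriveB d01 (is_deriveZ t d02)).
have al0 : al 0 = (p a * d a + n a) ^+ 2.
  by rewrite /al /B /A /lin /= !mulr0 !addr0 /xt /yt /adj2_1 /adj2_2; ring.
have be0 : be 0 = 0.
  by rewrite /be /B /A /lin /= !mulr0 !addr0 /x0 /y0 /adj2_1 /adj2_2; ring.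
have ga0 : ga 0 = 0.
  by rewrite /ga /B /A /lin /= !mulr0 !addr0 /xt /yt /adj2_1 /adj2_2; ring.
have de0 : de 0 = (p a * d a + n a) ^+ 2.
  by rewrite /de /B /A /lin /= !mulr0 !addr0 /x0 /y0 /adj2_1 /adj2_2; ring.
exists (fun e w => (al e * w + be e) / (ga e * w + de e)) => M0.
have [M MM0 [k k0 H]] := moebius_contraction _ _ _ _ _ _ _ _ _
  dt2 d02 dga dde al0 be0 ga0 de0 D20 hyp M0.
exists M => //; exists k => //; apply: filterS H => e H /H {H} [ke den ball lip].
split=> // z z0 zM.
(* Destructing [q] unfolds the full block, whose inner [q - 2] maps are then replaced by the squared
   adjugate. *)
case: q q2 Aq => [|[|q]] q2 Aq //.
have /= := iter_lin_adj2 _ _ _ _ _ _ z (ltnW q2) D0 Aq.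
rewrite !subSS subn0 -/(A a) => ->.
set c := g / _; set l := z.1 - t * z.2; set w := chart R t z.
have c0 : c != 0 by rewrite mulf_neq0 // invr_eq0 gt_eqF.
have z2 : z.2 = l * w by rewrite /w /chart mulrC divfK.
have z1 : z.1 = l * (1 + t * w).
  by rewrite mulrDr mulr1 mulrCA -z2 /l subrK.
have e2 : (A (a + u * e) (A (a + v * e) (c * adj2_1 R (p a) (n a) (d a) z.1 z.2,
    c * adj2_2 R (p a) (n a) (d a) z.1 z.2))).2 = c * l * (al e * w + be e).
  rewrite z1 z2 /al /be /B /A /lin /= /xt /yt /x0 /y0 /adj2_1 /adj2_2; ring.
have e1 : (A (a + u * e) (A (a + v * e) (c * adj2_1 R (p a) (n a) (d a) z.1 z.2,
    c * adj2_2 R (p a) (n a) (d a) z.1 z.2))).1 - t *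
    (A (a + u * e) (A (a + v * e) (c * adj2_1 R (p a) (n a) (d a) z.1 z.2,
    c * adj2_2 R (p a) (n a) (d a) z.1 z.2))).2 = c * l * (ga e * w + de e).
  rewrite z1 z2 /ga /de /B /A /lin /= /xt /yt /x0 /y0 /adj2_1 /adj2_2; ring.
split; first by rewrite e1; apply: mulf_neq0; [exact: mulf_neq0 | exact: den].
by rewrite /chart e1 e2 -mulf_div divff ?mul1r // mulf_neq0.
Qed.

(** Partial blocks are continuous in [e] and equal iterates of the unperturbed map at [e = 0]; the
    strict bound there leaves room for small [e]. *)
Lemma partial_block_cvg (R : realType) (p n d : R -> R) (a u v t M : R)
    (j : nat) (z : R * R) :
  {for a, continuous p} -> {for a, continuous n} -> {for a, continuous d} ->
  let A s := lin R (p s) (n s) (d s) in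
  (iter j (A a) z).1 - t * (iter j (A a) z).2 != 0 ->
  `|chart R t (iter j (A a) z)| < M ->
  \forall e \near (0 : R), let y := partial_block R A a u v j e z in
    y.1 - t * y.2 != 0 /\ `|chart R t y| <= M.
Proof.
move=> cp cn cd A l0 chM.
have E0 : partial_block R A a u v j 0 z = iter j (A a) z.
  by case: j {l0 chM} => [|[|j]] //=; rewrite !mulr0 !addr0.
have aff (f : R -> R) s : {for a, continuous f} ->
    f (a + s * e) @[e --> (0 : R)] --> f (a + s * 0).
  move=> cf; apply: (@cvg_comp _ _ _ (fun e => a + s * e) f (nbhs 0) (nbhs a)).
    have : a + s * e @[e --> (0 : R)] --> a + s * 0.
      by apply: cvgD; [exact: cvg_cst | apply: cvgMr; exact: cvg_id].
    by rewrite mulr0 addr0.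
  by rewrite mulr0 addr0; exact: cf.
have step (h : R -> R * R) s :
  (h e).1 @[e --> (0 : R)] --> (h 0).1 -> (h e).2 @[e --> (0 : R)] --> (h 0).2 ->
  (A (a + s * e) (h e)).1 @[e --> (0 : R)] --> (A (a + s * 0) (h 0)).1 /\
  (A (a + s * e) (h e)).2 @[e --> (0 : R)] --> (A (a + s * 0) (h 0)).2.
  move=> h1 h2; rewrite /A /lin /=; split.
    by apply: cvgB; apply: cvgM => //; exact: aff.
  by apply: cvgD => //; apply: cvgM => //; exact: aff.
have [c1 c2] : (partial_block R A a u v j e z).1 @[e --> (0 : R)] -->
     (partial_block R A a u v j 0 z).1 /\
   (partial_block R A a u v j e z).2 @[e --> (0 : R)] -->
     (partial_block R A a u v j 0 z).2.
  case: j {l0 chM E0} => [|[|j]] /=; first by split; exact: cvg_cst.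
    by apply: (step (fun=> z)); exact: cvg_cst.
  have [] := step (fun=> iter j (A a) z) v (cvg_cst _) (cvg_cst _).
  exact: (step (fun e => A (a + v * e) (iter j (A a) z))).
have cl : (partial_block R A a u v j e z).1 - t * (partial_block R A a u v j e z).2
  @[e --> (0 : R)] --> (iter j (A a) z).1 - t * (iter j (A a) z).2.
  by rewrite -E0; apply: cvgB => //; apply: cvgMr.
have cch : chart R t (partial_block R A a u v j e z) @[e --> (0 : R)] -->
   chart R t (iter j (A a) z).
  by apply: cvgM; [rewrite -E0 | apply: cvgV].
rewrite /=; near=> e; split; near: e; first exact: cvgr_neq0 cl l0.
by move/cvgr_norm_lt: cch => /(_ _ chM); apply: filterS => x; exact: ltW.
Unshelve. all: by end_near. Qed.

(** * Parameters of the perturbation and convergence *)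

(** The steps are cut off at [delta / 2], and index [0], where nothing is assumed on [r], gets [0].
    As [r] tends to [0], only finitely many terms change and the sum still diverges. *)
Lemma truncated_steps (R : realType) (r : nat -> R) (delta : R) :
  (forall i, (1 <= i)%N -> 0 < r i) -> r @ \oo --> (0 : R) ->
  (\sum_(1 <= i < n) r i) @[n --> \oo] --> +oo -> 0 < delta ->
  exists e : nat -> R, [/\ forall i, 0 <= e i < delta,
    forall i, (1 <= i)%N -> e i <= r i &
    (\sum_(0 <= i < n) e i) @[n --> \oo] --> +oo].
Proof.
move=> r0 rcvg roo d0.
pose e i := if i is 0%N then 0 else Num.min (r i) (delta / 2).
have e0 i : 0 <= e i < delta.
  case: i => [|i]; first by rewrite lexx.
  rewrite /e le_min gt_min (ltW (r0 _ _)) //= ltW ?divr_gt0 //=.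
  by rewrite [_ / 2 < _]ltr_pdivrMr // ltr_pMr // ltr1n orbT.
exists e; split=> //; first by case=> // i _; rewrite /e ge_min lexx.
have [N0 _ rN] : \forall i \near \oo, `|r i| < delta / 2.
  by move/cvgr0_norm_lt: rcvg; apply; rewrite divr_gt0.
have eN i : (N0 < i)%N -> e i = r i.
  case: i => // i iN; rewrite /e; apply/min_idPl.
  by rewrite (le_trans (ler_norm _)) // ltW // rN //= leqW.
apply/cvgryPge => K.
move/cvgryPge: roo => /(_ (K + \sum_(1 <= i < N0.+1) r i)) [N1 _ H].
exists (N0.+1 + N1)%N => // n /= nN.
have n1 : (N0.+1 <= n)%N by apply: leq_trans nN; rewrite leq_addr.
have := H n (leq_trans (leq_addl _ _) nN).
rewrite [leRHS](@big_cat_nat _ _ _ N0.+1) //= [leRHS]addrC lerD2r => h.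
rewrite [leRHS](@big_cat_nat _ _ _ N0.+1) //=.
rewrite ler_wpDl ?sumr_ge0 // => [i _|]; first by case/andP: (e0 i).
rewrite (le_trans h) //.
by rewrite ler_sum_nat // => i /andP[iN _]; rewrite eN.
Qed.

(** This is the common core of both claims. [P] records a condition on all parameters, such as
    positivity. *)
Lemma perturbed_convergence (R : realType) (T : R -> sphere R -> sphere R)
    (p n d : R -> R) (a p1 n1 d1 g : R) (q : nat) (P : set R) (r : nat -> R) :
  is_derive a (1 : R) p p1 -> is_derive a (1 : R) n n1 ->
  is_derive a (1 : R) d d1 ->
  p a + d a != 0 -> (p a - d a) ^+ 2 < 4 * n a -> (p1 != d1) || (n1 != 0) ->
  g != 0 -> (2 < q)%N ->
  (forall z, iter q (lin R (p a) (n a) (d a)) z = (g * z.1, g * z.2)) ->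
  (\forall s \near a, forall z, z != 0 ->
     T s (proj R z) = proj R (lin R (p s) (n s) (d s) z)) ->
  nbhs a P ->
  (forall i, (1 <= i)%N -> 0 < r i) -> r @ \oo --> (0 : R) ->
  (\sum_(1 <= i < m) r i) @[m --> \oo] --> +oo ->
  exists a_ : nat -> R, (forall i, P (a_ i)) /\
    [/\ a_ @ \oo --> a,
        converges_in_bd (approximant T a_),
        (forall i, (1 <= i)%N -> i != 1 %[mod q] -> i != 2 %[mod q] -> a_ i = a),
        (fun i : nat => a_ (q * i + 1)%N - a) =O_\oo r
      & (fun i : nat => a_ (q * i + 2)%N - a) =O_\oo r].
Proof.
move=> dp dn dd tr0 ell der g0 q2 Aq TA aP r0 rcvg roo.
pose A s := lin R (p s) (n s) (d s).
have D0 : p a * d a + n a != 0 by rewrite gt_eqF //; have := sqr_ge0 (p a + d a); nra.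
have orb0 j : iter j (A a) (0, 1) != 0.
  elim: j => [|j IH] /=; last exact: lin_neq0.
  by apply/eqP => -[/eqP]; rewrite oner_eq0.
(* [F] lists the orbit of [0] under the unperturbed map. A point at infinity contributes the
   quotient [0], a harmless extra exclusion. *)
pose F := [seq (iter j (A a) (0, 1)).1 / (iter j (A a) (0, 1)).2 | j <- iota 0 q].
have [t [u [v [tF ga1 hyp]]]] :=
  hyperbolic_direction _ _ _ _ _ _ _ F tr0 ell der.
have orbt j : (j < q)%N ->
    (iter j (A a) (0, 1)).1 - t * (iter j (A a) (0, 1)).2 != 0.
  move=> jq; have := orb0 j; move: tF; rewrite /F.
  case E : (iter j _ _) => [x y] /= tF z0.
  apply/eqP => /eqP; rewrite subr_eq0 => /eqP xy.
  have [y0|y0] := eqVneq y 0; first by move: z0; rewrite xy y0 mulr0 eqxx.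
  move/negP: tF; apply; apply/mapP; exists j; first by rewrite mem_iota.
  by rewrite -/(A a) E /= xy mulfK.
have [f Hf] := block_contraction _ _ _ _ _ _ _ _ g t u v q dp dn dd ga1 hyp D0 g0 q2 Aq.
(* [M0] exceeds the chart coordinates of all orbit points in absolute value, so that slightly
   perturbed partial blocks still send [0] into [[-M, M]]. *)
pose M0 := \sum_(j < q) `|chart R t (iter j (A a) (0, 1))| + 1.
have [M MM0 [k k0 Hk]] := Hf M0.
have chM (j : 'I_q) : `|chart R t (iter j (A a) (0, 1))| < M.
  rewrite (lt_le_trans _ MM0) // /M0 (bigD1 j) //= -addrA ltrDl.
  by rewrite ltr_wpDl // sumr_ge0.
have cont (h : R -> R) h1 : is_derive a (1 : R) h h1 -> {for a, continuous h}.
  by case=> ? _; apply/differentiable_continuous/derivable1_diffP.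
have cp := cont _ _ dp; have cn := cont _ _ dn; have cd := cont _ _ dd.
pose inI (z : R * R) := z.1 - t * z.2 != 0 /\ `|chart R t z| <= M.
have Hpart : \forall e \near (0 : R), forall j : 'I_q,
    inI (partial_block R A a u v j e (0, 1)).
  have := @filter_forall R 'I_q
    (fun j e => inI (partial_block R A a u v j e (0, 1))) (nbhs (0 : R)).
  apply=> j.
  by apply: (partial_block_cvg _ _ _ _ _ _ _ _ _ _ _ cp cn cd (orbt _ (ltn_ord j))).
pose good s := [/\ P s, p s * d s + n s != 0 & forall z, z != 0 ->
     T s (proj R z) = proj R (A s z)].
have Hgood : \forall s \near a, good s.
  have cD : p s * d s + n s @[s --> a] --> p a * d a + n a.
    by apply: cvgD => //; apply: cvgM.
  have nD : \forall s \near a, p s * d s + n s != 0 by exact: cvgr_neq0 cD D0.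
  by near=> s; split; near: s.
have Hgs (s : R) : \forall e \near (0 : R), good (a + s * e).
  have : a + s * e @[e --> (0 : R)] --> a + s * 0.
    by apply: cvgD; [exact: cvg_cst | apply: cvgMr; exact: cvg_id].
  by rewrite mulr0 addr0 => /(_ _ Hgood).
(* Each condition holds for [e] near [0]; one common [delta] secures them all for every step of the
   sequence. *)
have [delta d0 Hd] : exists2 delta, 0 < delta & forall e, 0 <= e < delta ->
    [/\ good (a + u * e), good (a + v * e),
    (forall j : 'I_q, inI (partial_block R A a u v j e (0, 1))) &
    [/\ k * e <= 1,
      forall w, `|w| <= M -> `|f e w| <= M,
      forall w z, `|w| <= M -> `|z| <= M ->
        `|f e w - f e z| <= (1 - k * e) * `|w - z|
    & forall z, z.1 - t * z.2 != 0 -> `|chart R t z| <= M ->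
      (partial_block R A a u v q e z).1 - t * (partial_block R A a u v q e z).2 != 0 /\
      chart R t (partial_block R A a u v q e z) = f e (chart R t z)]].
  have Hall : nbhs (0 : R) _ := filterI (filterI (Hgs u) (Hgs v)) (filterI Hpart Hk).
  have [delta /= d0 H] := (nbhs_ballP (0 : R) _).1 (Hall _ _ _); exists delta => // e /andP[e0 ed].
  have [|[gu gv] [He Hke]] := H e; last by split => //; exact: Hke.
  by rewrite /ball /= sub0r normrN ger0_norm.
have [e [e01 er eoo]] := truncated_steps _ _ _ r0 rcvg roo d0.
pose a_ := perturbation R a u v q e.
have a_good i : good (a_ i).
  rewrite /a_ /perturbation; have [gu gv _ _] := Hd _ (e01 (i %/ q)%N).
  case: ifP => // _; case: ifP => // _; rewrite mul0r addr0; exact: nbhs_singleton.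
exists a_; split; first by move=> i; case: (a_good i).
have er' i : (1 <= i)%N -> `|e i| <= `|r i|.
  move=> i1; case/andP: (e01 i) => ei0 _.
  by rewrite !ger0_norm ?er // ltW // r0.
have ecvg eps : 0 < eps -> exists N0, forall i, (N0 <= i)%N -> `|e i| < eps.
  move=> eps0; move/cvgr0_norm_lt: rcvg => /(_ _ eps0)[N0 _ H].
  exists N0.+1 => i iN; apply: (@le_lt_trans _ _ `|r i|).
    by apply: er'; exact: leq_ltn_trans iN.
  by apply: H; exact: ltnW.
have q1 : (1 < q)%N := ltnW q2.
have q0 : (0 < q)%N := ltnW q1.
have pert j : (j < q)%N -> forall i, a_ (q * i + j)%N - a =
    (if j == 1%N then u else if j == 2%N then v else 0) * e i.
  move=> jq i; rewrite /a_ /perturbation mulnC modnMDl modn_small // divnMDl //.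
  by rewrite divn_small // addn0 addrAC subrr add0r.
have bigO j : (j < q)%N -> (fun i : nat => a_ (q * i + j)%N - a) =O_\oo r.
  move=> jq; apply/eqO_exP; set c := (fun=> _).
  pose b := if j == 1%N then u else if j == 2%N then v else 0.
  exists (`|b| + 1); first exact: (ltr_wpDl (normr_ge0 b) ltr01).
  exists 1%N => // i i1 /=; rewrite /c pert // normrM.
  by apply: ler_pM => //; [rewrite lerDl | exact: er'].
split.
- apply/cvgrPdist_lt => eps eps0; set b := `|u| + `|v| + 1.
  have b0 : 0 < b by rewrite ltr_wpDl // addr_ge0.
  have [N0 HN0] := ecvg _ (divr_gt0 eps0 b0).
  exists (q * N0)%N => // N /= NN.
  rewrite /a_ /perturbation opprD addrA subrr sub0r normrN normrM.
  apply: (@le_lt_trans _ _ (b * `|e (N %/ q)%N|)).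
    rewrite ler_wpM2r // /b; have := normr_ge0 u; have := normr_ge0 v.
    by clear; case: ifP => _; [|case: ifP => _; rewrite ?normr0]; lra.
  by rewrite mulrC -ltr_pdivlMr // HN0 // leq_divRL // mulnC.
- pose V N := foldr (fun i => A (a_ i)) (0, 1) (iota 1 N).
  have VE N : approximant T a_ N = proj R (V N).
    rewrite /approximant; have -> : Some (0 : cplx R) = proj R (0, 1).
      by rewrite /proj /= oner_eq0 mul0r.
    suff [] : foldr (fun i => T (a_ i)) (proj R (0, 1)) (iota 1 N) = proj R (V N) /\
      V N != 0 by [].
    rewrite /V; elim: (iota 1 N) => [|i s [IH z0]] /=; first by split; [|exact: (orb0 0%N)].
    have [_ dn0 Tz] := a_good i; split; last exact: lin_neq0.
    exact: (etrans (congr1 (T (a_ i)) IH) (Tz _ z0)).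
  pose W N := chart R t (V N).
  (* The chart conjugates full blocks to the contractions [f (e i)], and the trailing [N %% q] maps
     supply the starting point [x]. *)
  have HW N : (V N).1 - t * (V N).2 != 0 /\ exists2 x, `|x| <= M &
      W N = foldr (fun i => f (e i)) x (iota 0 (N %/ q)).
    have step m k' z : inI z -> let y := foldr (fun i => partial_block R A a u v q (e i))
        z (iota k' m) in
        inI y /\ chart R t y = foldr (fun i => f (e i)) (chart R t z) (iota k' m).
      move=> Iz; elim: m k' => [//|m IH] k' /=.
      have [[z0 zM] <-] := IH k'.+1.
      have [_ _ _ [_ ball _ blk]] := Hd _ (e01 k').
      by have [y0 yE] := blk _ z0 zM; rewrite /inI yE; split; [split; [|apply: ball]|].
    have [_ _ Hj _] := Hd _ (e01 (N %/ q)%N).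
    have Nq : (N %% q < q)%N by rewrite ltn_mod.
    have [[V0 _] WN] := step (N %/ q)%N 0%N _ (Hj (Ordinal Nq)).
    have VN : V N = foldr (fun i => partial_block R A a u v q (e i))
      (partial_block R A a u v (N %% q) (e (N %/ q)%N) (0, 1)) (iota 0 (N %/ q)).
      rewrite /V [in iota 1 N](divn_eq N q) mulnC.
      exact: (foldr_blocks _ _ _ _ _ _ _ _ _ _ q2 (ltnW Nq)).
    split; first by rewrite VN.
    exists (chart R t (partial_block R A a u v (N %% q) (e (N %/ q)%N) (0, 1))).
      by have [] := Hj (Ordinal Nq).
    by rewrite /W VN.
  have /cvg_ex[/= l Wl] : cvgn W.
    apply: (nested_contraction_cvg _ (fun i => f (e i)) (fun i => k * e i) M q).
    + move=> i; have [_ _ _ [ke _ _ _]] := Hd _ (e01 i).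
      by rewrite ke andbT mulr_ge0 // ?(ltW k0) //; case/andP: (e01 i).
    + by [].
    + apply/cvgryPge => K; move/cvgryPge: eoo => /(_ (K / k)); apply: filterS => m.
      by rewrite -mulr_sumr ler_pdivrMr // mulrC.
    + by move=> i; case: (Hd _ (e01 i)) => _ _ _ [].
    + by move=> i; case: (Hd _ (e01 i)) => _ _ _ [].
    + by exists 0%N => // N _; case: (HW N).
  exists (real_pt R t l).
    by rewrite /real_pt; case: ifP.
  (* Continuity of [real_pt] carries the limit back to the sphere; [l = 0] means convergence to
     infinity. *)
  have -> : approximant T a_ = real_pt R t \o W.
    by apply/funext => N; rewrite VE (proj_chart _ t) //; case: (HW N).
  exact: (cvg_comp _ _ Wl (continuous_real_pt R t l)).
- move=> i i1 m1 m2; rewrite /a_ /perturbation.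
  move: m1 m2; rewrite (modn_small q1) (modn_small q2) => m1 m2.
  by rewrite (ifN _ _ m1) (ifN _ _ m2) mul0r addr0.
- exact: bigO.
- exact: bigO.
Unshelve. all: by end_near. Qed.

(** * Rotation numbers and roots of unity *)

Lemma periodic_int (R : realType) (f : R -> R) (m : int) (x : R) :
  periodic f (pi *+ 2) -> f (x + 2 * pi * m%:~R) = f x.
Proof.
move=> fper; have nat_per n y : f (y + 2 * pi * n%:R) = f y.
  rewrite -[RHS](periodicn fper n y); congr (f (y + _)).
  by rewrite -[RHS]mulr_natr -[pi *+ 2]mulr_natl.
case: m => n; first exact: nat_per.
by rewrite -(nat_per n.+1) NegzE mulrNz mulrN subrK.
Qed.

Lemma expi_int (R : realType) (m : int) : expi (2 * pi * m%:~R) = 1 :> cplx R.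
Proof.
rewrite /expi -[2 * pi * _]add0r (periodic_int _ _ _ _ (@cosD2pi R)).
by rewrite (periodic_int _ _ _ _ (@sinD2pi R)) cos0 sin0.
Qed.

Lemma expi_natM (R : realType) (t : R) (n : nat) :
  expi (n%:R * t) = (expi t : R[i]) ^+ n.
Proof.
elim: n => [|n IH]; first by rewrite mul0r /expi cos0 sin0 expr0.
rewrite exprS -IH -natr1 mulrDl mul1r addrC /expi cosD sinD.
by apply/eqP; rewrite eq_complex /= [sin t * _ + _]addrC !eqxx.
Qed.

Lemma expi_root_of_unity (R : realType) (rho : R) (m : int) (q : nat) :
  q%:R * rho = m%:~R -> (expi (- (2 * pi * rho)) : R[i]) ^+ q = 1.
Proof.
move=> qrho; rewrite -expi_natM mulrN mulrCA qrho -mulrN -mulrNz.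
exact: expi_int.
Qed.

(** For the fractional part [y], the sine is positive on [0 < y < 1/2], and a shift by [pi] treats
    [1/2 < y < 1] in the same way. *)
Lemma sin_2pi_eq0 (R : realType) (x : R) :
  sin (2 * pi * x) = 0 -> eq_mod1 x 0 \/ eq_mod1 x 2^-1.
Proof.
pose k := Num.floor x; pose y := x - k%:~R.
have xy : x = y + k%:~R by rewrite subrK.
have y0 : 0 <= y by rewrite subr_ge0 floor_le.
have y1 : y < 1 by rewrite ltrBlDl -[X in _ + X]/(1%:~R) -intrD floorD1_gt.
have pi0 := pi_gt0 R.
rewrite [in sin _]xy mulrDr (periodic_int _ _ _ _ (@sinD2pi R)) => siny.
have [y00|yn0] := eqVneq y 0.
  by left; rewrite /eq_mod1 subr0 xy y00 add0r intr_int.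
have [y12|yn12] := eqVneq y 2^-1.
  by right; rewrite /eq_mod1 xy y12 addrAC subrr add0r intr_int.
have yp : 0 < y by rewrite lt_neqAle eq_sym yn0.
have [h|h] := ltP y 2^-1.
  have : 0 < sin (2 * pi * y).
    by apply: sin_gt0_pi; rewrite !mulr_gt0 //= mulrAC gtr_pMl //; lra.
  by rewrite siny ltxx.
have : 0 < sin (2 * pi * y - pi).
  have yh : 2^-1 < y by rewrite lt_neqAle eq_sym yn12.
  apply: sin_gt0_pi; apply/andP; split; nra.
by rewrite sinB siny cospi sinpi !mul0r mulr0 subrr ltxx.
Qed.

(** * Normal form of elliptic maps of the half-plane *)

(** With [l = l1 + i l2] and [s = s1 + i s2] the hypothesis is [|s| <= |l s + 2 i|] on [Im s >= -1].
    On the boundary line a real quadratic is nonnegative; its discriminant leaves [l = 1] or a range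
    in which the zero [-2 i / l] of the right side lies in the half-plane, which is absurd. *)
Lemma normal_form_rigidity (R : realType) (l1 l2 : R) :
  (forall s1 s2, -1 <= s2 -> s1 ^+ 2 + s2 ^+ 2 <=
     (l1 * s1 - l2 * s2) ^+ 2 + (2 + l1 * s2 + l2 * s1) ^+ 2) ->
  l1 = 1 /\ l2 = 0.
Proof.
move=> H; pose N := l1 ^+ 2 + l2 ^+ 2.
have disc : (4 * l2) ^+ 2 - 4 * (N - 1) * (N + 3 - 4 * l1) <= 0.
  pose P := Poly [:: N + 3 - 4 * l1; 4 * l2; N - 1].
  have Pge t : 0 <= P.[t].
    rewrite /P horner_Poly /=; have := H t (-1) (lexx _); rewrite /N; lra.
  have := deg_le2_poly_ge0 (size_Poly _ : (size P <= 3)%N) Pge.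
  by rewrite /P !coef_Poly.
(* The factor [2 * l1 - N - 1] is [- |l - 1|^2], hence nonnegative only for [l = 1]. *)
have e3 : 0 <= (2 * l1 - N - 1) * (2 * l1 - N + 3) by rewrite /N in disc *; lra.
have [h|h] := leP 1 (2 * l1 - N).
  have : (l1 - 1) ^+ 2 + l2 ^+ 2 <= 0 by rewrite /N in h; lra.
  have := sqr_ge0 (l1 - 1); have := sqr_ge0 l2 => p1 p2 p3.
  have /eqP : l2 ^+ 2 = 0 by lra.
  have /eqP : (l1 - 1) ^+ 2 = 0 by lra.
  by rewrite !sqrf_eq0 subr_eq0 => /eqP -> /eqP ->.
have h3 : 2 * l1 - N + 3 <= 0.
  rewrite leNgt; apply/negP => h3; move: e3; rewrite leNgt => /negP; apply.
  by rewrite nmulr_rlt0 // subr_lt0.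
have N0 : 0 < N.
  rewrite lt_neqAle eq_sym addr_ge0 ?sqr_ge0 // andbT; apply/eqP => N0.
  move: (N0) => /eqP; rewrite /N paddr_eq0 ?sqr_ge0 // !sqrf_eq0 => /andP[/eqP l10 _].
  by move: h3; rewrite N0 l10; lra.
(* This is the imaginary part of [-2 i / l]. *)
have s2 : -1 <= - 2 * l1 / N by rewrite ler_pdivlMr //; lra.
have := H (- 2 * l2 / N) _ s2.
have -> : l1 * (- 2 * l2 / N) - l2 * (- 2 * l1 / N) = 0 by ring.
have -> : 2 + l1 * (- 2 * l1 / N) + l2 * (- 2 * l2 / N) = 0.
  rewrite /N; field; exact: lt0r_neq0.
have -> : (- 2 * l2 / N) ^+ 2 + (- 2 * l1 / N) ^+ 2 = 4 / N.
  rewrite /N; field; exact: lt0r_neq0.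
by rewrite expr0n /= addr0 leNgt divr_gt0.
Qed.

(** The squared modulus takes values in [R] rather than [R[i]], so that inequalities become real
    polynomial ones. *)
Definition sqn (R : realType) (z : R[i]) : R :=
  complex.Re z ^+ 2 + complex.Im z ^+ 2.

Lemma sqnM (R : realType) (z w : R[i]) : sqn R (z * w) = sqn R z * sqn R w.
Proof. by case: z => a b; case: w => c d; rewrite /sqn /=; ring. Qed.

Lemma sqn_ge0 (R : realType) (z : R[i]) : 0 <= sqn R z.
Proof. by rewrite addr_ge0 ?sqr_ge0. Qed.

Lemma sqn_eq0 (R : realType) (z : R[i]) : (sqn R z == 0) = (z == 0).
Proof.
by case: z => a b; rewrite /sqn paddr_eq0 ?sqr_ge0 // !sqrf_eq0 eq_complex.
Qed.

Lemma sqn_gt0 (R : realType) (z : R[i]) : (0 < sqn R z) = (z != 0).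
Proof. by rewrite lt_neqAle sqn_ge0 andbT eq_sym sqn_eq0. Qed.

(* [T(z) - c] and [T(z) - conj c] have numerators [(al - ga c)(z - c)] and
   [k (2 i y + l (z - c))]; as [T] preserves the half-plane, the former is the
   smaller one, and this for all [z] forces [l = 1]. *)
Lemma elliptic_coefficients (R : realType) (al be ga de : R[i]) (x y : R) :
  let c := x +i* y in
  0 < y -> al * c + be = c * (ga * c + de) -> ga * c + de != 0 ->
  sqn R (al - ga * c) = sqn R (ga * c + de) ->
  (forall z, 0 <= complex.Im z -> ga * z + de != 0 ->
     0 <= complex.Im ((al * z + be) / (ga * z + de))) ->
  al = de + (2 * x)%:C * ga /\ be = - (x ^+ 2 + y ^+ 2)%:C * ga.
Proof.
move=> c y0 fixc k0 sqnK HT; set k := ga * c + de in fixc k0 sqnK.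
pose cb := x -i* y; pose l := (al - ga * cb) / k.
have lk : l * k = al - ga * cb by rewrite /l divfK.
have beE : be = c * k - al * c by rewrite -fixc addrC addKr.
have deE : de = k - ga * c by rewrite /k addrC addKr.
have ineq z : 0 <= complex.Im z ->
    sqn R (z - c) <= sqn R ((c - cb) + l * (z - c)).
  move=> z0; have k1 : 0 < sqn R k by rewrite sqn_gt0.
  rewrite -(ler_pM2l k1) -[X in X * sqn _ (z - c)]sqnK -!sqnM.
  have -> : (al - ga * c) * (z - c) = (al * z + be) - c * (ga * z + de).
    by rewrite beE deE; ring.
  have -> : k * (c - cb + l * (z - c)) = (al * z + be) - cb * (ga * z + de).
    by rewrite mulrDr mulrA [k * l]mulrC lk beE deE; ring.
  have [d0|d0] := eqVneq (ga * z + de) 0; first by rewrite d0 !mulr0.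
  have := HT z z0 d0; set w := _ / _ => w0.
  have -> : al * z + be = w * (ga * z + de) by rewrite /w divfK.
  rewrite -!mulrBl !sqnM ler_wpM2r ?sqn_ge0 //.
  move: w0; case: w => a b /= b0; rewrite /sqn /= lerD2l; nra.
have [l1 l2] : complex.Re l = 1 /\ complex.Im l = 0.
  apply: normal_form_rigidity => s1 s2 s21.
  (* In the variable [s] with [z = c + y s] the half-plane becomes [Im s >= -1]. *)
  have := ineq (c + (y * s1 +i* (y * s2))); rewrite /= => /(_ _) H.
  have /H : 0 <= y + y * s2 by nra.
  rewrite /c /cb; case: (l) => l1 l2; rewrite /sqn /= => {}H.
  have y20 : 0 < y ^+ 2 by rewrite exprn_gt0.
  rewrite -(ler_pM2l y20); move: H; lra.
have l10 : l = 1 by apply/eqP; rewrite eq_complex l1 l2 !eqxx.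
have alE : al = k + ga * cb by rewrite -[k]mul1r -l10 lk subrK.
split.
  have -> : (2 * x)%:C = c + cb :> R[i].
    by apply/eqP; rewrite eq_complex /= subrr eqxx andbT; apply/eqP; ring.
  by rewrite alE /k; ring.
have -> : (x ^+ 2 + y ^+ 2)%:C = c * cb :> R[i].
  by apply/eqP; rewrite eq_complex /=; apply/andP; split; apply/eqP; ring.
by rewrite beE alE; ring.
Qed.

Lemma expi_sqn (R : realType) (t : R) : sqn R (expi t) = 1.
Proof. exact: cos2Dsin2. Qed.

(** The product rule is applied to [al * z + be = f z * (ga * z + de)], valid near [c], where the
    denominator does not vanish. *)
Lemma is_derive_moebius (R : realType) (T : sphere R -> sphere R)
    (al be ga de c l : cplx R) :
  T =1 moebius al be ga de -> T (Some c) = Some c ->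
  is_derive c (1 : cplx R) ((fun z => odflt 0 (T (Some z))) : cplx R -> cplx R) l ->
  [/\ al * c + be = c * (ga * c + de), ga * c + de != 0 &
      l * (ga * c + de) = (al : R[i]) - ga * c].
Proof.
move=> TE Tc [dT dl].
move: (Tc); rewrite TE /=; case: ifPn => // k0 [fixc].
have fixc' : al * c + be = c * (ga * c + de) by rewrite -[X in _ = X * _]fixc divfK.
split=> //.
set f := (fun z => _) in dT dl.
have df : is_derive c (1 : cplx R) f l by [].
have daff (m b : cplx R) : is_derive c (1 : cplx R) (fun z : cplx R => m * z + b) m.
  have h := is_deriveD (is_deriveZ m (is_derive_id c (1 : cplx R)))
    (is_derive_cst b c (1 : cplx R)).
  by apply: (is_derive_eq h); rewrite addr0 /GRing.scale /= mulr1.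
have dden := daff ga de.
have cden : {for c, continuous (fun z : cplx R => ga * z + de)}.
  by apply/differentiable_continuous/derivable1_diffP; case: dden.
have d0 : \forall z \near c, ga * z + de != 0.
  by exact: (@cvgr_neq0 _ _ _ (nbhs c) _ (fun z : cplx R => ga * z + de) _ cden k0).
have prodE : \forall z \near c, al * z + be = f z * (ga * z + de).
  by apply: filterS d0 => z z0; rewrite /f TE /= (negbTE z0) /= divfK.
have h1 := near_eq_is_derive prodE (daff al be).
have h2 := is_deriveM df dden.
have : f c *: ga + (ga * c + de) *: l = al.
  by rewrite -(@derive_val _ _ _ _ _ _ _ h2) -(@derive_val _ _ _ _ _ _ _ h1).
by rewrite /f Tc /GRing.scale /= => <-; ring.
Qed.

(* [v |-> v.1 - c v.2] is an eigenform of [lin p n d] when [c] is a fixed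
   point, with eigenvalue [p - c]. *)
Lemma iter_lin_scalar (R : realType) (p n d x y : R) (q : nat) :
  y != 0 -> p - d = 2 * x -> n = x ^+ 2 + y ^+ 2 ->
  ((p - x) -i* y : R[i]) ^+ q = ((p - x) +i* y) ^+ q ->
  exists2 g : R, g != 0 &
    forall z, iter q (lin R p n d) z = (g * z.1, g * z.2).
Proof.
move=> y0 dE nE pq; pose c : R[i] := x +i* y; pose k : R[i] := (p - x) -i* y.
pose phi (z : R * R) : R[i] := z.1%:C - c * z.2%:C.
have k0 : k != 0 by rewrite eq_complex /= oppr_eq0 (negbTE y0) andbF.
have step z : phi (lin R p n d z) = k * phi z.
  apply/eqP; rewrite eq_complex /phi /lin /c /k /= nE.
  have -> : d = p - 2 * x by rewrite -dE; ring.
  by apply/andP; split; apply/eqP; ring.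
have iterE z j : phi (iter j (lin R p n d) z) = k ^+ j * phi z.
  by elim: j => [|j IH]; rewrite ?mul1r //= step IH exprS mulrA.
have kreal : complex.Im (k ^+ q) = 0.
  have : (k ^+ q)^*%C = k ^+ q.
    by rewrite rmorphXn /= opprK -pq.
  by case: (k ^+ q) => u v [] /=; lra.
pose g := complex.Re (k ^+ q).
have kg : k ^+ q = g%:C by move: kreal; rewrite /g; case: (k ^+ q) => u v /= ->.
exists g.
  by apply: contra_neq (expf_neq0 q k0) => g0; rewrite kg g0.
move=> z; have := iterE z q; case: (iter _ _ _) => u v.
rewrite kg /phi /c => /eqP; rewrite eq_complex /= => /andP[/eqP h1 /eqP h2].
have v2 : v = g * z.2.
  by apply: (mulfI y0); move: h2; lra.
by congr (_, _) => //; move: h1; rewrite v2; lra.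
Qed.

(** The common complex factor [ga] cancels; infinity, the pole and all other points are treated
    separately. *)
Lemma moebius_proj (R : realType) (al be ga de : R[i]) (p n d : R) (z : R * R) :
  al = p%:C * ga -> be = - n%:C * ga -> de = d%:C * ga -> ga != 0 -> z != 0 ->
  moebius (al : cplx R) be ga de (proj R z) = proj R (lin R p n d z).
Proof.
move=> -> -> -> ga0; case: z => u v z0; rewrite /proj /lin /=.
have [v0|v0] := eqVneq v 0.
  rewrite v0 !mulr0 !addr0 subr0 /= (negbTE ga0).
  have u0 : u != 0 by apply: contra z0 => /eqP ->; rewrite v0.
  by rewrite (negbTE u0) mulfK // mulfK.
rewrite /=.
have denE : ga * (u / v)%:C + d%:C * ga = ((u + d * v) / v)%:C * ga :> R[i].
  by rewrite mulrC -mulrDl -rmorphD /=; congr (_%:C * _); field.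
have numE : p%:C * ga * (u / v)%:C + - n%:C * ga = ((p * u - n * v) / v)%:C * ga :> R[i].
  by rewrite mulrAC -mulrDl -rmorphM -rmorphN -rmorphD /=; congr (_%:C * _); field.
rewrite denE numE mulf_eq0 (negbTE ga0) orbF.
have -> : (((u + d * v) / v)%:C == 0 :> R[i]) = (u + d * v == 0).
  by rewrite eq_complex /= eqxx andbT mulf_eq0 invr_eq0 (negbTE v0) orbF.
case: ifPn => // d0; congr Some.
rewrite -mulf_div divff // mulr1 -fmorph_div; congr (_%:C); field.
by rewrite d0 v0.
Qed.

(** Up to the factor [ga] the coefficients form a real matrix. The alternative in the hypothesis
    serves the parameter [a], where the angle is known, and nearby parameters, where [ga != 0]
    follows by continuity. *)
Lemma elliptic_normal_form (R : realType) (T : sphere R -> sphere R)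
    (al be ga de c : R[i]) (rho : R) :
  T =1 moebius (al : cplx R) be ga de -> T @` halfplane R = halfplane R ->
  has_rotation_number T rho -> int_halfplane R c -> T (Some c) = Some c ->
  sin (2 * pi * rho) != 0 \/ ga != 0 ->
  let x := complex.Re c in let y := complex.Im c in
  let d := complex.Re (de / ga : R[i]) in
  [/\ ga != 0, al = (d + 2 * x)%:C * ga :> R[i],
      be = - (x ^+ 2 + y ^+ 2)%:C * ga :> R[i], de = d%:C * ga :> R[i] &
      (expi (- (2 * pi * rho)) : R[i]) * ((d + x) +i* y) = (d + x) -i* y :> R[i]].
Proof.
move=> TE TH [c' [c'0 Tc' Tder]] c0 Tc singa x y d.
have [fixc' k0 lk] : [/\ al * c' + be = c' * (ga * c' + de) :> R[i],
    ga * (c' : R[i]) + de != 0 &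
    (expi (- (2 * pi * rho)) : R[i]) * (ga * c' + de) = al - ga * c'].
  exact: is_derive_moebius TE Tc' Tder.
case: c' c'0 Tc' Tder fixc' k0 lk => x' y' /= y'0 Tc' _ fixc' k0 lk.
have [alE beE] : al = de + (2 * x')%:C * ga :> R[i] /\
    be = - (x' ^+ 2 + y' ^+ 2)%:C * ga :> R[i].
  apply: (elliptic_coefficients _ _ _ _ _ _ y' y'0 fixc' k0).
    by rewrite -lk sqnM expi_sqn mul1r.
  move=> z z0 d0.
  have : halfplane R (T (Some (z : cplx R))) by rewrite -TH; exists (Some (z : cplx R)).
  by rewrite TE /= (negbTE d0).
(* If [ga] vanished, then [al = de], the multiplier would be [1] and the sine [0]. *)
have ga0 : ga != 0.
  case: singa => // s0; apply: contra_neq s0 => ga0.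
  move: lk k0; rewrite alE ga0 !mulr0 !mul0r !addr0 add0r subr0 => lk de0.
  have : expi (- (2 * pi * rho)) = 1 :> R[i] by apply: (mulIf de0); rewrite mul1r.
  by move=> [_ /eqP]; rewrite sinN oppr_eq0 => /eqP.
pose m : R[i] := de / ga + x'%:C; pose iy : R[i] := 0 +i* y'.
have cE : x' +i* y' = x'%:C + iy :> R[i].
  by apply/eqP; rewrite eq_complex /= add0r addr0 !eqxx.
have deE : de = (m - x'%:C) * ga :> R[i] by rewrite /m addrK divfK.
have kE : ga * (x' +i* y') + de = (m + iy) * ga :> R[i].
  by rewrite cE deE; ring.
have KE : al - ga * (x' +i* y') = (m - iy) * ga :> R[i].
  by rewrite alE rmorphM rmorph_nat cE deE; ring.
have lm : (expi (- (2 * pi * rho)) : R[i]) * (m + iy) = m - iy :> R[i].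
  by apply: (mulIf ga0); rewrite -[LHS]mulrA -kE lk KE.
(* A multiplier of modulus [1] gives [|m + i y'| = |m - i y'|], which forces [m] to be real. *)
have mreal : complex.Im m = 0.
  have : sqn R (m + iy) = sqn R (m - iy).
    by rewrite -lm sqnM expi_sqn mul1r.
  case: (m) => m1 m2; rewrite /sqn /= => h.
  have : y' * m2 = 0 by lra.
  by move/eqP; rewrite mulf_eq0 (gt_eqF y'0) => /eqP.
have dE : de / ga = d%:C :> R[i].
  apply/eqP; rewrite eq_complex /d eqxx /=; apply/eqP.
  by move: mreal; rewrite /m; case: (de / ga) => u v /=; rewrite addr0.
have mE : m = (d + x')%:C by rewrite /m dE rmorphD.
have deE' : de = d%:C * ga :> R[i] by rewrite -dE divfK.
have alE' : al = (d + 2 * x')%:C * ga :> R[i].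
  by rewrite alE deE' -mulrDl rmorphD.
(* The rotation number comes with its own fixed point [c']; the fixed-point equation has a single
   root in the open half-plane, so [c' = c]. *)
have [xx yy] : x' = x /\ y' = y.
  have fixc : al * c + be = c * (ga * c + de) :> R[i].
    move: Tc; rewrite TE /=; case: ifPn => // kc [fixc].
    by rewrite -[X in _ = X * _]fixc; exact: (esym (divfK kc _)).
  have : ga * ((d + 2 * x')%:C * c - (x' ^+ 2 + y' ^+ 2)%:C - c * (c + d%:C)) = 0 :> R[i].
    move: fixc; rewrite alE' beE deE' => fixc.
    transitivity ((d + 2 * x')%:C * ga * c + - (x' ^+ 2 + y' ^+ 2)%:C * ga -
      c * (ga * c + d%:C * ga) : R[i]); first by ring.
    by rewrite fixc subrr.
  move/eqP; rewrite mulf_eq0 (negbTE ga0) /= eq_complex => /andP[/eqP].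
  rewrite /x /y; move: c0; move: (d) => d'; case: (c) => X Y; rewrite /int_halfplane /=.
  move=> Y0 h1 /eqP h2; have xX : x' = X.
    by apply: (mulIf (lt0r_neq0 Y0)); lra.
  split=> //; move: h1; rewrite xX => h1.
  have : (y' - Y) * (y' + Y) = 0 by lra.
  by move/eqP; rewrite mulf_eq0 subr_eq0 (gt_eqF (addr_gt0 y'0 Y0)) orbF => /eqP.
rewrite xx yy in alE' beE mE; split=> //.
have mp : m + iy = (d + x) +i* y :> R[i].
  by apply/eqP; rewrite mE eq_complex /= add0r addr0 yy !eqxx.
have mn : m - iy = (d + x) -i* y :> R[i].
  by apply/eqP; rewrite mE eq_complex /= oppr0 add0r addr0 yy !eqxx.
by rewrite -mp -mn.
Qed.

(** * Harmonic step sizes and the two claims *)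

Lemma harmonic_sum_dvg (R : realType) :
  (\sum_(1 <= i < n) (i%:R^-1 : R)) @[n --> \oo] --> +oo.
Proof.
have h : series (@harmonic R) n @[n --> \oo] --> +oo.
  apply: nondecreasing_dvgn_lt (@dvg_harmonic R).
  by apply: nondecreasing_series => n _ _; exact: harmonic_ge0.
rewrite -(cvg_shiftS _) /=.
apply: cvg_trans h; apply: near_eq_cvg; exists 0%N => // n _ /=.
by rewrite big_add1 /series /=.
Qed.

Theorem theorem1p7 (R : realType) :
  (forall a : R, 4^-1 < a ->
     (exists rho : rat, has_rotation_number (cf_map a) (ratr rho)) ->
     exists a_ : nat -> R,
       [/\ forall i, (1 <= i)%N -> 0 < a_ i,
           a_ @ \oo --> a
         & converges_in_bd (approximant (@cf_map R) a_)])
  /\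
  (forall (T : R -> sphere R -> sphere R) (c : R -> cplx R) (rho : R -> R),
     smooth_moebius_family T ->
     (forall s, elliptic (T s)) ->
     csmooth c ->
     (forall s, int_halfplane R (c s)) ->
     (forall s, T s (Some (c s)) = Some (c s)) ->
     (forall s, has_rotation_number (T s) (rho s)) ->
     forall (a : R) (p : int) (q : nat), (1 <= q)%N ->
     eq_mod1 (rho a) (p%:~R / q%:R) ->
     ~ eq_mod1 (rho a) 0 ->
     ~ eq_mod1 (rho a) (2^-1) ->
     cderive1 c a != 0 ->
     (exists a_ : nat -> R,
        a_ @ \oo --> a /\ converges_in_bd (approximant T a_))
     /\
     (forall r : nat -> R,
        (forall i, (1 <= i)%N -> 0 < r i) ->
        r @ \oo --> (0 : R) ->
        (\sum_(1 <= i < n) r i) @[n --> \oo] --> +oo ->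
        exists a_ : nat -> R,
          [/\ a_ @ \oo --> a,
              converges_in_bd (approximant T a_),
              (forall i, (1 <= i)%N ->
                 i != 1 %[mod q] -> i != 2 %[mod q] -> a_ i = a),
              (fun i : nat => a_ (q * i + 1)%N - a) =O_\oo r
            & (fun i : nat => a_ (q * i + 2)%N - a) =O_\oo r])).
Proof.
(* The steps [1 / i] serve wherever no sequence [r] is prescribed. *)
have hcvg : (fun i : nat => i%:R^-1 : R) @ \oo --> (0 : R).
  by rewrite -(cvg_shiftS _) /=; exact: cvg_harmonic.
have hpos i : (1 <= i)%N -> 0 < (i%:R^-1 : R) by move=> i1; rewrite invr_gt0 ltr0n.
split.
  move=> a a4 [rho [[x y] [/= y0 Tc Tder]]].
  have [fixc k0 lk] : [/\ 0 * (x +i* y) + - a%:C =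
        (x +i* y) * (1 * (x +i* y) + 1) :> R[i],
      1 * (x +i* y) + 1 != 0 :> R[i] &
      (expi (- (2 * pi * ratr rho)) : R[i]) * (1 * (x +i* y) + 1) =
      0 - 1 * (x +i* y)].
    exact: (is_derive_moebius _ (cf_map a) _ _ _ _ _ _ (fun=> erefl) Tc Tder).
  have [xE aE] : 0 - 1 = 2 * x /\ a = x ^+ 2 + y ^+ 2.
    move: fixc; rewrite mul0r add0r mul1r => /eqP; rewrite eq_complex /=.
    move=> /andP[/eqP h1 /eqP h2].
    have xE : 2 * x = -1 by apply: (mulIf (lt0r_neq0 y0)) => /=; lra.
    split; first by lra.
    have : x * (2 * x + 1) = 0 by rewrite xE addNr mulr0.
    by lra.
  (* The factor [3] makes the block length exceed [2]; any positive multiple of the denominator is a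
     period of the rotation. *)
  pose q := (3 * `|denq rho|)%N.
  have q2 : (2 < q)%N.
    by rewrite /q (@leq_trans (3 * 1)%N) // leq_mul2l /= absz_gt0 denq_neq0.
  have lamq : (expi (- (2 * pi * ratr rho : R)) : R[i]) ^+ q = 1.
    apply: (expi_root_of_unity _ _ (3 * numq rho)).
    rewrite /q natrM natr_absz gtr0_norm ?denq_gt0 // intrM -mulrA; congr (_ * _).
    have := congr1 (@ratr R) (numqE rho); rewrite rmorphM /= !ratr_int => ->.
    by rewrite mulrC.
  have [g g0 Aq] : exists2 g : R, g != 0 &
      forall z, iter q (lin R 0 a 1) z = (g * z.1, g * z.2).
    apply: (iter_lin_scalar _ 0 a 1 x y q (lt0r_neq0 y0) xE aE).
    have -> : (0 - x) -i* y = (expi (- (2 * pi * ratr rho)) : R[i]) * ((0 - x) +i* y).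
      have -> : (0 - x) +i* y = 1 * (x +i* y) + 1 :> R[i].
        by apply/eqP; rewrite mul1r eq_complex /=; apply/andP; split; apply/eqP; lra.
      rewrite lk; apply/eqP; rewrite mul1r eq_complex /=; apply/andP; split; apply/eqP; lra.
    by rewrite exprMn lamq mul1r.
  have tr : 0 + 1 != 0 :> R by rewrite add0r oner_neq0.
  have dsc : (0 - 1) ^+ 2 < 4 * a by lra.
  have der : (0 != 0 :> R) || (1 != 0 :> R) by rewrite oner_neq0 orbT.
  have near_cf : \forall s \near a, forall z, z != 0 ->
      cf_map s (proj R z) = proj R (lin R 0 s 1 z).
    by apply: filterE => s z z0; apply: moebius_proj => //; rewrite ?mulr1 ?oner_neq0.
  have near_pos : \forall s \near a, 0 < s by apply: lt_nbhsr; lra.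
  have [a_ [a_pos [a_cvg a_conv _ _ _]]] := perturbed_convergence _ (@cf_map R)
    (fun=> 0) id (fun=> 1) a 0 1 0 g q [set s | 0 < s] _
    (is_derive_cst _ _ _) (is_derive_id _ _) (is_derive_cst _ _ _) tr dsc der
    g0 q2 Aq near_cf near_pos hpos hcvg (harmonic_sum_dvg R).
  by exists a_; split=> // i _; exact: a_pos.
move=> T c rho [al [be [ga [de [sal sbe sga sde TE]]]]] ell [sRe sIm] c0 Tc rot.
move=> a p q q1 rhoq rho0 rho12 dc.
(* A denominator [1] or [2] would make [rho a] congruent to [0] or [1/2]. *)
have q2 : (2 < q)%N.
  move: q1 rhoq; case: q => [|[|[|q]]] // _.
    rewrite divr1 => /rpredD /(_ (intr_int _ p)); rewrite subrK => h.
    by case: rho0; rewrite /eq_mod1 subr0.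
  move=> rhoq; have pE := divz_eq p 2.
  have : (0 <= p %% 2)%Z && (p %% 2 < 2)%Z by rewrite modz_ge0 // ltz_pmod.
  case: (p %% 2)%Z pE => [[|[|]]|] // pE _; [case: rho0 | case: rho12].
    move: rhoq; rewrite /eq_mod1 subr0 pE addr0 intrM mulfK ?pnatr_eq0 //.
    by move=> /rpredD /(_ (intr_int _ (p %/ 2)%Z)); rewrite subrK.
  move: rhoq; rewrite /eq_mod1 pE intrD intrM mulrDl mulfK ?pnatr_eq0 // mul1r.
  move=> /rpredD /(_ (intr_int _ (p %/ 2)%Z)).
  by rewrite opprD addrA addrAC subrK.
have s0 : sin (2 * pi * rho a) != 0.
  by apply/eqP => /sin_2pi_eq0 [].
have TH s : T s @` halfplane R = halfplane R by case: (ell s) => -[].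
pose x s := complex.Re (c s); pose y s := complex.Im (c s).
pose d s := complex.Re (de s / ga s : R[i]).
have NF s := elliptic_normal_form _ _ _ _ _ _ _ _ (TE s).2 (TH s) (rot s) (c0 s) (Tc s).
have [ga0 _ _ _ lam] := NF a (or_introl s0).
have lamq : (expi (- (2 * pi * rho a)) : R[i]) ^+ q = 1.
  have q0 : q%:R != 0 :> R by rewrite pnatr_eq0 -lt0n.
  move: rhoq => /intrP[m mE].
  apply: (expi_root_of_unity _ _ (p + m * q%:Z)).
  have -> : rho a = p%:~R / q%:R + m%:~R by rewrite -mE addrC subrK.
  by rewrite mulrDr mulrC divfK // intrD intrM [q%:R * _]mulrC.
have y0 s : 0 < y s := c0 s.
have [g g0 Aq] : exists2 g : R, g != 0 &
    forall z, iter q (lin R (d a + 2 * x a) (x a ^+ 2 + y a ^+ 2) (d a)) z =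
    (g * z.1, g * z.2).
  apply: (iter_lin_scalar _ _ _ _ (x a) (y a)) => //; first exact: lt0r_neq0.
    by rewrite addrC addKr.
  have -> : d a + 2 * x a - x a = d a + x a by ring.
  by rewrite -lam exprMn lamq mul1r.
(* This is half the trace of the matrix. If it were [0], the real part of [lam] would make [y a]
   times the sine vanish. *)
have tr0 : d a + x a != 0.
  apply: contra s0 => /eqP dx0; move: lam; rewrite -/(d a) -/(x a) -/(y a) dx0.
  case=> h _; move: h; rewrite mulr0 sub0r sinN mulNr opprK => /eqP.
  by rewrite mulf_eq0 (gt_eqF (y0 a)) orbF.
have dx : derivable x a 1 by exact: (sRe 0%N a).
have dy : derivable y a 1 by exact: (sIm 0%N a).
pose u1 s := complex.Re (ga s); pose u2 s := complex.Im (ga s).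
pose v1 s := complex.Re (de s); pose v2 s := complex.Im (de s).
have du1 : derivable u1 a 1 by exact: (sga.1 0%N a).
have du2 : derivable u2 a 1 by exact: (sga.2 0%N a).
have dv1 : derivable v1 a 1 by exact: (sde.1 0%N a).
have dv2 : derivable v2 a 1 by exact: (sde.2 0%N a).
have dN := derivableD (derivableM du1 du1) (derivableM du2 du2).
have NE s : (u1 * u1 + u2 * u2) s = sqn R (ga s) by rewrite /sqn !expr2.
have N0 : (u1 * u1 + u2 * u2) a != 0 by rewrite NE sqn_eq0.
have dd : derivable d a 1.
  (* The quotient is rewritten as [Re (de * conj ga) / |ga|^2], whose parts are differentiable. *)
  have -> : d = (v1 * u1 + v2 * u2) * (fun s => ((u1 * u1 + u2 * u2) s)^-1).
    apply/funext => s; rewrite /d /v1 /v2 /u1 /u2 !fctE.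
    by case: (ga s) => g1 g2; case: (de s) => e1 e2 /=; ring.
  exact: (derivableM (derivableD (derivableM dv1 du1) (derivableM dv2 du2))
    (derivableV N0 dN)).
have gan : \forall s \near a, ga s != 0.
  have cN : {for a, continuous (u1 * u1 + u2 * u2)}.
    by apply/differentiable_continuous/derivable1_diffP.
  have : \forall s \near a, (u1 * u1 + u2 * u2) s != 0 by exact: cvgr_neq0 cN N0.
  by apply: filterS => s; rewrite NE sqn_eq0.
have core (r : nat -> R) : (forall i, (1 <= i)%N -> 0 < r i) ->
  r @ \oo --> (0 : R) -> (\sum_(1 <= i < n) r i) @[n --> \oo] --> +oo ->
  exists a_ : nat -> R,
          [/\ a_ @ \oo --> a,
              converges_in_bd (approximant T a_),
              (forall i, (1 <= i)%N ->
                 i != 1 %[mod q] -> i != 2 %[mod q] -> a_ i = a),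
              (fun i : nat => a_ (q * i + 1)%N - a) =O_\oo r
            & (fun i : nat => a_ (q * i + 2)%N - a) =O_\oo r].
  move=> r0 rcvg rsum.
  have dX := derivableP dx; have dY := derivableP dy; have dD := derivableP dd.
  have dp : is_derive a (1 : R) (fun s => d s + 2 * x s) ('D_1 d a + 2 * 'D_1 x a).
    exact: (is_deriveD dD (is_deriveZ 2 dX)).
  have dn : is_derive a (1 : R) (fun s => x s ^+ 2 + y s ^+ 2)
      (x a * 'D_1 x a + x a * 'D_1 x a + (y a * 'D_1 y a + y a * 'D_1 y a)).
    exact: (is_deriveD (is_deriveM dX dX) (is_deriveM dY dY)).
  have tr : d a + 2 * x a + d a != 0.
    have -> : d a + 2 * x a + d a = 2 * (d a + x a) by ring.
    by rewrite mulf_neq0 ?pnatr_eq0.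
  have dsc : (d a + 2 * x a - d a) ^+ 2 < 4 * (x a ^+ 2 + y a ^+ 2).
    by have : 0 < y a ^+ 2 by [rewrite exprn_gt0]; lra.
  (* With primes for derivatives at [a], the difference of the diagonal derivatives is [2 x'] and
     the last derivative is [2 (x x' + y y')]. As [y a > 0], both vanish only if [c'(a) = 0]. *)
  have der : ('D_1 d a + 2 * 'D_1 x a != 'D_1 d a) ||
    (x a * 'D_1 x a + x a * 'D_1 x a + (y a * 'D_1 y a + y a * 'D_1 y a) != 0).
    rewrite -negb_and; apply: contra dc => /andP[/eqP h1 /eqP h2].
    have x0 : 'D_1 x a = 0 by lra.
    have y1 : y a * 'D_1 y a = 0 by move: h2; rewrite x0; lra.
    have {}y1 : 'D_1 y a = 0.
      by move/eqP: y1; rewrite mulf_eq0 (gt_eqF (y0 a)) => /eqP.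
    by rewrite /cderive1 !derive1E -/x -/y x0 y1.
  have near_T : \forall s \near a, forall z, z != 0 ->
      T s (proj R z) = proj R (lin R (d s + 2 * x s) (x s ^+ 2 + y s ^+ 2) (d s) z).
    apply: filterS gan => s gs z z0; rewrite (TE s).2.
    have [_ alE beE deE _] := NF s (or_intror gs).
    exact: moebius_proj.
  have [a_ [_ H]] := perturbed_convergence _ T _ _ _ a _ _ _ g q setT r
    dp dn dD tr dsc der g0 q2 Aq near_T filterT r0 rcvg rsum.
  by exists a_.
split; last exact: core.
have [a_ [a_cvg a_conv _ _ _]] := core _ hpos hcvg (harmonic_sum_dvg R).
by exists a_.
Qed.
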